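(* Let $A$ be an Auslander--Gorenstein algebra. Let $I$ be an indecomposable injective $A$-module of projective dimension $r$. Let $P$ be the indecomposable projective $A$-module with $\operatorname{top}(P)=\phi(\operatorname{soc}(I))$, where $\phi$ is the grade bijection. Then $P$ has injective dimension $r$. The $r$-th (final) term in the minimal projective resolution of $I$ is $P$, and the $r$-th (final) term in the minimal injective coresolution of $P$ is $I$.
   Context: Algebras are finite-dimensional over a field $K$; modules are finitely generated right modules; $D=\operatorname{Hom}_K(-,K)$. Let $0\to A\to I^0\to I^1\to\cdots$ be a minimal injective coresolution of $A$. $A$ is Auslander--Gorenstein if $\operatorname{pdim} I^i\le i$ for all $i\ge 0$ and $\operatorname{idim} A<\infty$. For a simple module $S$, $\operatorname{grade}S=g_S=\inf\{i\ge 0\mid \operatorname{Ext}_A^i(S,A)\ne 0\}$. For $A$ Auslander--Gorenstein, the grade bijection $\phi$ on isomorphism classes of simple $A$-modules is $\phi(S)=\operatorname{top}\big(D\operatorname{Ext}_A^{g_S}(S,A)\big)$ (known to be a well-defined bijection). Terms of resolutions are indexed starting from $0$. *)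

(* Defs.v *)
From HB Require Import structures.
From mathcomp Require Import all_boot all_order all_algebra all_field.
From mathcomp Require Import boolp.

Set Implicit Arguments.
Unset Strict Implicit.
Unset Printing Implicit Defensive.

Import GRing.Theory.
Local Open Scope ring_scope.

Section Span.
Variables (K : fieldType) (V : vectType K).

Fact pspan_subproof (Q : V -> Prop) : exists U : {vspace V},
  (forall x, Q x -> x \in U) /\
  (forall W : {vspace V}, (forall x, Q x -> x \in W) -> (U <= W)%VS).
Proof.
pose good (U : {vspace V}) :=
  forall W : {vspace V}, (forall x, Q x -> x \in W) -> (U <= W)%VS.
suff H k (U : {vspace V}) : (\dim {:V} - \dim U <= k)%N -> good U ->
    exists U' : {vspace V}, (forall x, Q x -> x \in U') /\ good U'.
  by apply: (H _ 0%VS (leqnn _)) => W _; exact: sub0v.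
elim: k U => [|k IHk] U hk gU.
  exists U; split=> // x _; suff -> : U = fullv by exact: memvf.
  by apply/eqP; rewrite eqEdim subvf -subn_eq0 -leqn0.
have [h|h] := pselect (forall x, Q x -> x \in U); first by exists U.
have [x Qx xU] : exists2 x, Q x & x \notin U.
  have [//|h'] := pselect (exists2 x, Q x & x \notin U); case: h => x Qx.
  by apply/negPn/negP => xU; apply: h'; exists x.
apply: (IHk (U + <[x]>)%VS) => [|W QW]; last first.
  by rewrite subv_add (gU W QW) -memvE QW.
have: (\dim U < \dim (U + <[x]>))%N.
  rewrite ltnNge; apply: contra xU => le.
  have /eqP -> : U == (U + <[x]>)%VS by rewrite eqEdim addvSl.
  by rewrite memvE addvSr.
move=> lt; rewrite -ltnS; apply: leq_trans hk.
apply: ltn_sub2l => //; apply: leq_trans lt _; exact: dimvS (subvf _).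
Qed.

(* The linear span of an arbitrary set of vectors. *)
Definition pspan (Q : V -> Prop) : {vspace V} := sval (cid (pspan_subproof Q)).

Lemma mem_pspan (Q : V -> Prop) x : Q x -> x \in pspan Q.
Proof. by rewrite /pspan; case: cid => U [? ?] /=; auto. Qed.

Lemma pspan_le (Q : V -> Prop) (W : {vspace V}) :
  (forall x, Q x -> x \in W) -> (pspan Q <= W)%VS.
Proof. by rewrite /pspan; case: cid => U [? ?] /=; auto. Qed.

Lemma pspanP (Q : V -> Prop) :
    Q 0 -> (forall (k : K) x y, Q x -> Q y -> Q (k *: x + y)) ->
  forall x, x \in pspan Q <-> Q x.
Proof.
move=> Q0 QD x; split=> [|/mem_pspan//].
suff [U UQ] : exists U : {vspace V}, forall y, (y \in U) = `[< Q y >].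
  move=> xQ; apply/asboolP; rewrite -UQ; apply: subvP xQ; apply: pspan_le.
  by move=> y Qy; rewrite UQ; apply/asboolP.
exists (pspan Q) => y; apply/idP/asboolP => [yQ|/mem_pspan//].
suff H n (X : n.-tuple V) : (forall i, Q X`_i) -> forall z, z \in <<X>>%VS -> Q z.
  have [n [X [XQ eX]]] : exists n (X : n.-tuple V),
      (forall i, Q X`_i) /\ (pspan Q <= <<X>>)%VS.
    suff H2 k (s : seq V) : (\dim {:V} - \dim <<s>> <= k)%N ->
        (forall i, Q s`_i) ->
        exists s' : seq V, (forall i, Q s'`_i) /\ (pspan Q <= <<s'>>)%VS.
      have [s [sQ es]] : exists s' : seq V,
          (forall i, Q s'`_i) /\ (pspan Q <= <<s'>>)%VS.
        by apply: (H2 _ [::] (leqnn _)) => i; rewrite nth_nil.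
      by exists (size s), (in_tuple s).
    elim: k s => [|k IHk] s hk sQ.
      exists s; split=> //; suff -> : <<s>>%VS = fullv by exact: subvf.
      by apply/eqP; rewrite eqEdim subvf -subn_eq0 -leqn0.
    have [h|h] := pselect (forall x, Q x -> x \in <<s>>%VS).
      by exists s; split=> //; exact: pspan_le.
    have [z Qz zs] : exists2 z, Q z & z \notin <<s>>%VS.
      have [//|h'] := pselect (exists2 z, Q z & z \notin <<s>>%VS).
      case: h => z Qz; apply/negPn/negP => zs; apply: h'; by exists z.
    apply: (IHk (z :: s)) => [|[|i] //=].
    rewrite span_cons.
    have: (\dim <<s>> < \dim (<[z]> + <<s>>))%N.
      rewrite ltnNge; apply: contra zs => le.
      have /eqP -> : <<s>>%VS == (<[z]> + <<s>>)%VS by rewrite eqEdim addvSr.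
      by rewrite memvE addvSl.
    move=> lt; rewrite -ltnS; apply: leq_trans hk.
    apply: ltn_sub2l => //; apply: leq_trans lt _; exact: dimvS (subvf _).
  exact: (H n X XQ) (subvP eX _ yQ).
move=> XQ z /coord_span ->; elim/big_ind: _ => //.
  by move=> u v Qu Qv; rewrite -[u]scale1r; exact: QD.
by move=> i _; rewrite -[X in Q X]addr0; exact: QD.
Qed.

End Span.

Inductive side := Rgt | Lft.

Definition smul (s : side) (R : pzRingType) (a b : R) : R :=
  if s is Rgt then a * b else b * a.

(* Finitely generated modules over a finite-dimensional algebra are the modules
   of finite K-dimension.  Scalars are written on the right in both cases: in a
   left module, x ** a stands for a x.                                        *)
Record module (s : side) (K : fieldType) (A : falgType K) := Module {
  mod_sort :> vectType K;
  mact : mod_sort -> A -> mod_sort;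
  mact_linearl : forall a, linear (mact^~ a);
  mact_linearr : forall x, linear (mact x);
  mact1 : forall x, mact x 1 = x;
  mactM : forall x a b, mact x (smul s a b) = mact (mact x a) b }.

Notation "x ** a" := (mact x a) (at level 40, left associativity).
Notation rmod := (module Rgt).
Notation lmod := (module Lft).

Section ModuleTheory.
Variables (s : side) (K : fieldType) (A : falgType K).
Implicit Types M N : module s A.

Lemma mactPl M (a : A) (k : K) (x y : M) :
  (k *: x + y) ** a = k *: (x ** a) + y ** a.
Proof. exact: mact_linearl. Qed.

Lemma mactPr M (x : M) (k : K) (a b : A) :
  x ** (k *: a + b) = k *: (x ** a) + x ** b.
Proof. exact: mact_linearr. Qed.

Definition mactl M (a : A) (x : M) : M := x ** a.
HB.instance Definition _ M (a : A) :=
  GRing.isLinear.Build K M M _ (@mactl M a) (@mact_linearl s K A M a).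

Lemma mact0l M (a : A) : (0 : M) ** a = 0.
Proof. exact: (linear0 (@mactl M a)). Qed.

Lemma mactBl M (a : A) (x y : M) : (x - y) ** a = x ** a - y ** a.
Proof. exact: (linearB (@mactl M a)). Qed.

Definition mactf M (a : A) : 'End(M) := linfun (@mactl M a).

Lemma mactfE M a x : mactf M a x = x ** a.
Proof. exact: lfunE. Qed.

Lemma mact0r M (x : M) : x ** (0 : A) = 0.
Proof. by have := mactPr x (-1) 0 0; rewrite !scaleN1r !addNr. Qed.

Record rhom M N := RHom {
  rhom_fun :> 'Hom(M, N);
  rhomP : forall x a, rhom_fun (x ** a) = rhom_fun x ** a }.

Record submod M := SubMod {
  submod_sp :> {vspace M};
  submodP : forall x a, x \in submod_sp -> x ** a \in submod_sp }.

Definition zero_mod M : Prop := \dim {:M} = 0%N.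

Definition iso M N : Prop := exists f : rhom M N, lker f = 0%VS /\ limg f = fullv.

Section SubQuotient.
Variables (M : module s A) (U : submod M).

Definition sub_act (x : subvs_of U) a : subvs_of U := vsproj U (vsval x ** a).

Lemma sub_actE x a : vsval (sub_act x a) = vsval x ** a.
Proof. by rewrite vsprojK // submodP // subvsP. Qed.

Fact sub_linl a : linear (sub_act^~ a).
Proof.
move=> k x y /=; apply: subvs_inj; rewrite sub_actE !(linearP (@vsval K M U)).
by rewrite /= !sub_actE mactPl.
Qed.
Fact sub_linr x : linear (sub_act x).
Proof.
move=> k a b; apply: subvs_inj.
by rewrite sub_actE (linearP (@vsval K M U)) /= !sub_actE mactPr.
Qed.
Fact sub_act1 x : sub_act x 1 = x.
Proof. by apply: subvs_inj; rewrite sub_actE mact1. Qed.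
Fact sub_actM x a b : sub_act x (smul s a b) = sub_act (sub_act x a) b.
Proof. by apply: subvs_inj; rewrite !sub_actE mactM. Qed.

Definition sub_mod : module s A := Module sub_linl sub_linr sub_act1 sub_actM.

Fact incl_subproof (x : sub_mod) a :
  (linfun vsval : 'Hom(sub_mod, M)) (x ** a) =
  (linfun vsval : 'Hom(sub_mod, M)) x ** a.
Proof. by rewrite !lfunE /= sub_actE. Qed.

Definition incl : rhom sub_mod M := RHom incl_subproof.

(* M / U is carried by a linear complement of U, the class of x being its
   projection along U.                                                        *)
Definition quo_proj (x : M) : subvs_of (U^C)%VS :=
  vsproj (U^C)%VS (daddv_pi (U^C)%VS U x).

Fact quo_proj_linear : linear quo_proj.
Proof. by move=> k x y; rewrite /quo_proj !linearP. Qed.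
HB.instance Definition _ :=
  GRing.isLinear.Build K M (subvs_of (U^C)%VS) _ quo_proj quo_proj_linear.

Lemma quo_capC : (U^C :&: U)%VS = 0%VS.
Proof. by rewrite capvC capv_compl. Qed.

Lemma quo_projE x : x - vsval (quo_proj x) \in (U : {vspace M}).
Proof.
rewrite vsprojK ?memv_pi //.
have /(daddv_pi_add quo_capC) {1}<- : x \in (U^C + U)%VS.
  by rewrite addvC addv_complf memvf.
by rewrite addrAC subrr add0r memv_pi.
Qed.

Lemma quo_proj_eq0 x : (quo_proj x == 0) = (x \in (U : {vspace M})).
Proof.
apply/eqP/idP => [h|xU]; first by have := quo_projE x; rewrite h subr0.
apply: val_inj; rewrite /= vsprojK ?memv_pi //.
have : daddv_pi U^C U x \in (U^C :&: U)%VS.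
  rewrite memv_cap memv_pi /=.
  have := quo_projE x; rewrite vsprojK ?memv_pi // => h.
  by rewrite -[X in X \in _](subKr x) memvB.
by rewrite quo_capC memv0 => /eqP.
Qed.

Lemma quo_projK (x : subvs_of (U^C)%VS) : quo_proj (vsval x) = x.
Proof.
apply: val_inj; rewrite /= vsprojK ?memv_pi //.
by apply: (daddv_pi_id quo_capC); exact: subvsP.
Qed.

Definition quo_act (x : subvs_of (U^C)%VS) a : subvs_of (U^C)%VS :=
  quo_proj (vsval x ** a).

Lemma quo_actE x a : quo_act (quo_proj x) a = quo_proj (x ** a).
Proof.
apply/eqP; rewrite -subr_eq0 -linearB quo_proj_eq0 /=.
by rewrite -mactBl submodP // -opprB memvN quo_projE.
Qed.

Fact quo_linl a : linear (quo_act^~ a).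
Proof. by move=> k x y; rewrite /quo_act !linearP /= mactPl linearP. Qed.
Fact quo_linr x : linear (quo_act x).
Proof. by move=> k a b; rewrite /quo_act mactPr linearP. Qed.
Fact quo_act1 x : quo_act x 1 = x.
Proof. by rewrite /quo_act mact1 quo_projK. Qed.
Fact quo_actM x a b : quo_act x (smul s a b) = quo_act (quo_act x a) b.
Proof. by rewrite -[x]quo_projK !quo_actE mactM. Qed.

Definition quo_mod : module s A := Module quo_linl quo_linr quo_act1 quo_actM.

End SubQuotient.

Definition simple_mod M : Prop :=
  ~ zero_mod M /\
  forall U : submod M, (U : {vspace M}) = 0%VS \/ (U : {vspace M}) = fullv.

Definition indecomposable M : Prop :=
  ~ zero_mod M /\
  forall U W : submod M, (U + W)%VS = fullv -> (U :&: W)%VS = 0%VS ->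
    (U : {vspace M}) = 0%VS \/ (W : {vspace M}) = 0%VS.

Definition maximal_submod M (U : submod M) : Prop :=
  (U : {vspace M}) <> fullv /\
  forall W : submod M, (U <= W)%VS ->
    (W : {vspace M}) = U \/ (W : {vspace M}) = fullv.

Section TopSoc.
Variable M : module s A.

Let rad_pred (x : M) : Prop :=
  forall U : submod M, maximal_submod U -> x \in (U : {vspace M}).

Let rad_pred0 : rad_pred 0.
Proof. by move=> U _; exact: mem0v. Qed.
Let rad_predD (k : K) x y : rad_pred x -> rad_pred y -> rad_pred (k *: x + y).
Proof. by move=> hx hy U mU; rewrite memvD ?memvZ ?hx ?hy. Qed.

Definition rad_sp : {vspace M} :=
  pspan (fun x : M =>
    forall U : submod M, maximal_submod U -> x \in (U : {vspace M})).

Lemma rad_spP x : x \in rad_sp <->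
  forall U : submod M, maximal_submod U -> x \in (U : {vspace M}).
Proof. exact: (pspanP rad_pred0 rad_predD). Qed.

Fact rad_subproof x a : x \in rad_sp -> x ** a \in rad_sp.
Proof. by move=> /rad_spP h; apply/rad_spP => U /h; exact: submodP. Qed.

(* The intersection of the maximal submodules. *)
Definition rad : submod M := SubMod rad_subproof.

Definition top : module s A := quo_mod rad.

Definition soc_sp : {vspace M} :=
  pspan (fun x : M =>
    exists2 U : submod M, simple_mod (sub_mod U) & x \in (U : {vspace M})).

Fact soc_subproof x a : x \in soc_sp -> x ** a \in soc_sp.
Proof.
move=> xS; rewrite -mactfE.
suff: (soc_sp <= mactf M a @^-1: soc_sp)%VS by move/subvP/(_ _ xS); rewrite memv_preim.
apply: pspan_le => y [U sU yU]; rewrite -memv_preim mactfE.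
by apply: mem_pspan; exists U => //; exact: submodP.
Qed.

(* The sum of the simple submodules. *)
Definition soc : module s A := sub_mod (SubMod soc_subproof).

End TopSoc.

Definition projective P : Prop :=
  forall (M N : module s A) (g : rhom M N) (f : rhom P N), limg g = fullv ->
    exists h : rhom P M, forall x, g (h x) = f x.

Definition injective_mod I : Prop :=
  forall (M N : module s A) (g : rhom M N) (f : rhom M I), lker g = 0%VS ->
    exists h : rhom N I, forall x, h (g x) = f x.

Definition superfluous M (U : {vspace M}) : Prop :=
  forall W : submod M, (U + W)%VS = fullv -> (W : {vspace M}) = fullv.

Definition essential M (U : {vspace M}) : Prop :=
  forall W : submod M, (U :&: W)%VS = 0%VS -> (W : {vspace M}) = 0%VS.

Record projres M := ProjRes {
  pr_term :> nat -> module s A;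
  pr_d : forall i, rhom (pr_term i.+1) (pr_term i);
  pr_aug : rhom (pr_term 0%N) M;
  pr_proj : forall i, projective (pr_term i);
  pr_surj : limg pr_aug = fullv;
  pr_exact0 : limg (pr_d 0%N) = lker pr_aug;
  pr_exact : forall i, limg (pr_d i.+1) = lker (pr_d i) }.

Record injcores M := InjCores {
  ic_term :> nat -> module s A;
  ic_d : forall i, rhom (ic_term i) (ic_term i.+1);
  ic_coaug : rhom M (ic_term 0%N);
  ic_inj : forall i, injective_mod (ic_term i);
  ic_mono : lker ic_coaug = 0%VS;
  ic_exact0 : limg ic_coaug = lker (ic_d 0%N);
  ic_exact : forall i, limg (ic_d i) = lker (ic_d i.+1) }.

(* Every term is a projective cover of the corresponding syzygy. *)
Definition minimal_projres M (R : projres M) : Prop :=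
  superfluous (lker (pr_aug R)) /\ forall i, superfluous (lker (pr_d R i)).

(* Every term is an injective envelope of the corresponding cosyzygy. *)
Definition minimal_injcores M (R : injcores M) : Prop :=
  essential (limg (ic_coaug R)) /\ forall i, essential (limg (ic_d R i)).

Definition pdim_le M (n : nat) : Prop :=
  exists R : projres M, forall i, (n < i)%N -> zero_mod (R i).

Definition idim_le M (n : nat) : Prop :=
  exists R : injcores M, forall i, (n < i)%N -> zero_mod (R i).

Definition has_pdim M (n : nat) : Prop :=
  pdim_le M n /\ forall k, pdim_le M k -> (n <= k)%N.

Definition has_idim M (n : nat) : Prop :=
  idim_le M n /\ forall k, idim_le M k -> (n <= k)%N.

Definition final_term (t : nat -> module s A) (r : nat) (X : module s A) : Prop :=
  iso (t r) X /\ forall i, (r < i)%N -> zero_mod (t i).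

Section Kernels.
Variables (M N : module s A) (f : rhom M N).

Fact ker_subproof x a : x \in lker f -> x ** a \in lker f.
Proof. by rewrite !memv_ker rhomP => /eqP ->; rewrite mact0l. Qed.
Definition ker_mod : submod M := SubMod ker_subproof.

Fact im_subproof y a : y \in limg f -> y ** a \in limg f.
Proof. by case/memv_imgP=> x _ ->; rewrite -rhomP memv_img // memvf. Qed.
Definition im_mod : submod N := SubMod im_subproof.

End Kernels.

Fact zero_subproof M x a : x \in (0%VS : {vspace M}) -> x ** a \in 0%VS.
Proof. by rewrite !memv0 => /eqP ->; rewrite mact0l. Qed.
Definition zero_sub M : submod M := SubMod (@zero_subproof M).

Fact meet_subproof M (Z B : submod M) (x : sub_mod Z) a :
  x \in (incl Z @^-1: B)%VS -> x ** a \in (incl Z @^-1: B)%VS.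
Proof. by rewrite -!memv_preim rhomP; exact: submodP. Qed.

(* The subquotient Z / (Z :&: B). *)
Definition subquo_mod M (Z B : submod M) : module s A :=
  quo_mod (SubMod (@meet_subproof M Z B)).

Fact comp_subproof (M N L : module s A) (g : rhom N L) (f : rhom M N) x a :
  (g \o f)%VF (x ** a) = (g \o f)%VF x ** a.
Proof. by rewrite !comp_lfunE !rhomP. Qed.
Definition rhom_comp (M N L : module s A) (g : rhom N L) (f : rhom M N) : rhom M L :=
  RHom (@comp_subproof M N L g f).

End ModuleTheory.

Section Regular.
Variables (K : fieldType) (A : falgType K).

Fact reg_linl (a : A) : linear (fun x : A => x * a).
Proof. by move=> k x y; rewrite mulrDl scalerAl. Qed.
Fact reg_linr (x : A) : linear (fun a : A => x * a).
Proof. by move=> k a b; rewrite mulrDr scalerAr. Qed.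

Definition reg : rmod A :=
  @Module Rgt K A A (fun x a => x * a) reg_linl reg_linr (@mulr1 A) (@mulrA A).

End Regular.

Section Free.
Variables (K : fieldType) (A : falgType K) (n : nat).

Definition free_act (x : {ffun 'I_n -> A}) (a : A) : {ffun 'I_n -> A} :=
  [ffun i => x i * a].

Fact free_linl a : linear (free_act^~ a).
Proof. by move=> k x y; apply/ffunP=> i; rewrite !ffunE mulrDl scalerAl. Qed.
Fact free_linr x : linear (free_act x).
Proof. by move=> k a b; apply/ffunP=> i; rewrite !ffunE mulrDr scalerAr. Qed.
Fact free_act1 x : free_act x 1 = x.
Proof. by apply/ffunP=> i; rewrite !ffunE mulr1. Qed.
Fact free_actM x a b : free_act x (a * b) = free_act (free_act x a) b.
Proof. by apply/ffunP=> i; rewrite !ffunE mulrA. Qed.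

Definition free_mod : rmod A := @Module Rgt K A _ _ free_linl free_linr free_act1 free_actM.

Section FreeHom.
Variables (M : rmod A) (v : 'I_n -> M).

Definition free_fun (x : free_mod) : M := \sum_i v i ** x i.

Fact free_fun_linear : linear free_fun.
Proof.
move=> k x y; rewrite /free_fun scaler_sumr -big_split.
by apply: eq_bigr => i _ /=; rewrite !ffunE mactPr.
Qed.
HB.instance Definition _ :=
  GRing.isLinear.Build K free_mod M _ free_fun free_fun_linear.

Fact free_hom_subproof x a : linfun free_fun (x ** a) = linfun free_fun x ** a.
Proof.
rewrite !lfunE /= /free_fun -[RHS]mactfE linear_sum; apply: eq_bigr => i _.
by rewrite /= mactfE ffunE -mactM.
Qed.

Definition free_hom : rhom free_mod M := RHom free_hom_subproof.

Lemma free_homE x : free_hom x = \sum_i v i ** x i.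
Proof. exact: lfunE. Qed.

End FreeHom.

Definition free_basis (i : 'I_n) : free_mod := [ffun j => (j == i)%:R].

Lemma free_decomp (x : free_mod) : x = \sum_i free_basis i ** x i.
Proof.
apply/ffunP=> j; rewrite sum_ffunE (bigD1 j) //= big1 ?addr0 => [|i ij].
  by rewrite !ffunE eqxx mul1r.
by rewrite !ffunE eq_sym (negPf ij) mul0r.
Qed.

Lemma free_projective : projective free_mod.
Proof.
move=> M N g f sg; exists (free_hom (fun i => (g^-1)%VF (f (free_basis i)))) => x.
rewrite free_homE [in RHS](free_decomp x) !linear_sum; apply: eq_bigr => i _.
rewrite /= rhomP limg_lfunVK ?sg ?memvf //; symmetry; exact: (rhomP f (free_basis i) (x i)).
Qed.

End Free.

Section FreeResolution.
Variables (K : fieldType) (A : falgType K).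
Implicit Type M : rmod A.

Definition cover M : rhom (free_mod A (\dim {:M})) M :=
  free_hom (fun i => (vbasis {:M})`_i).

Lemma cover_surj M : limg (cover M) = fullv.
Proof.
apply/vspaceP=> y; rewrite memvf; apply/memv_imgP.
exists [ffun i => (coord (vbasis {:M}) i y)%:A]; first exact: memvf.
rewrite free_homE {1}(coord_vbasis (memvf y)).
apply: eq_bigr => i _; rewrite ffunE.
by rewrite -[_%:A]addr0 mactPr mact1 mact0r addr0.
Qed.

Definition syz M : rmod A := sub_mod (ker_mod (cover M)).

Definition fres_term M i := free_mod A (\dim {: iter i syz M}).

Definition fres_d M i : rhom (fres_term M i.+1) (fres_term M i) :=
  rhom_comp (incl (ker_mod (cover (iter i syz M)))) (cover (iter i.+1 syz M)).

Lemma limg_incl M (U : submod M) : limg (incl U) = U.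
Proof.
apply/vspaceP=> y; apply/memv_imgP/idP => [[x _ ->]|yU].
  by rewrite lfunE /= subvsP.
by exists (vsproj U y); rewrite ?memvf // lfunE /= vsprojK.
Qed.

Lemma lker_incl M (U : submod M) : lker (incl U) = 0%VS.
Proof.
apply/vspaceP=> y; rewrite memv_ker memv0 lfunE /=.
by apply/eqP/eqP => [h|->]; [apply: val_inj | rewrite linear0].
Qed.

Lemma limg_fres_d M i : limg (fres_d M i) = lker (cover (iter i syz M)).
Proof. by rewrite limg_comp cover_surj limg_incl. Qed.

Lemma lker_fres_d M i : lker (fres_d M i) = lker (cover (iter i.+1 syz M)).
Proof.
apply/vspaceP=> x; rewrite !memv_ker comp_lfunE.
by rewrite -memv_ker lker_incl memv0.
Qed.

Definition free_res M : projres M :=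
  @ProjRes Rgt K A M (fres_term M) (fres_d M) (cover M)
    (fun i => @free_projective K A _) (cover_surj M) (limg_fres_d M 0%N)
    (fun i => etrans (limg_fres_d M i.+1) (esym (lker_fres_d M i))).

End FreeResolution.

(* Hom_A(M, A) as a left A-module, (a f)(x) = a f(x). *)
Section DualA.
Variables (K : fieldType) (A : falgType K).
Implicit Type M : rmod A.

Definition homA_sp M : {vspace 'Hom(M, A)} :=
  pspan (fun f : 'Hom(M, A) => forall x a, f (x ** a) = f x * a).

Lemma homA_spP M (f : 'Hom(M, A)) :
  f \in homA_sp M <-> forall x a, f (x ** a) = f x * a.
Proof.
pose Q (g : 'Hom(M, A)) := forall x a, g (x ** a) = g x * a.
have Q0 : Q 0 by move=> x a; rewrite !zero_lfunE mul0r.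
have QD (k : K) g h : Q g -> Q h -> Q (k *: g + h).
  by move=> hg hh x a; rewrite !add_lfunE !scale_lfunE hg hh mulrDl scalerAl.
exact: (pspanP Q0 QD f).
Qed.

Definition homA_act M (f : subvs_of (homA_sp M)) (a : A) :
    subvs_of (homA_sp M) :=
  vsproj (homA_sp M) (amull (a : A) \o vsval f)%VF.

Lemma homA_actE M f a x : vsval (@homA_act M f a) x = (a : A) * vsval f x.
Proof.
rewrite vsprojK ?comp_lfunE ?lfunE //; apply/homA_spP => y b.
have /homA_spP hf := subvsP f.
by rewrite !comp_lfunE !lfunE /= hf mulrA.
Qed.

Fact homA_linl M a : linear ((@homA_act M)^~ a).
Proof.
move=> k f g /=; apply: subvs_inj; apply/lfunP => x.
rewrite homA_actE !(linearP (@vsval _ _ (homA_sp M))) /=.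
by rewrite !add_lfunE !scale_lfunE !homA_actE mulrDr scalerAr.
Qed.
Fact homA_linr M f : linear (@homA_act M f).
Proof.
move=> k a b; apply: subvs_inj; apply/lfunP => x.
rewrite homA_actE (linearP (@vsval _ _ (homA_sp M))) /=.
by rewrite add_lfunE scale_lfunE !homA_actE mulrDl scalerAl.
Qed.
Fact homA_act1 M f : @homA_act M f 1 = f.
Proof. by apply: subvs_inj; apply/lfunP => x; rewrite homA_actE mul1r. Qed.
Fact homA_actM M f a b :
  @homA_act M f (b * a) = homA_act (homA_act f a) b.
Proof.
by apply: subvs_inj; apply/lfunP => x; rewrite !homA_actE mulrA.
Qed.

Definition homA M : lmod A :=
  @Module Lft K A _ _ (@homA_linl M) (@homA_linr M) (@homA_act1 M) (@homA_actM M).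

End DualA.

Section ExtA.
Variables (K : fieldType) (A : falgType K).
Implicit Type M : rmod A.

Definition precomp_fun M N (f : rhom M N) (g : homA N) : homA M :=
  vsproj (homA_sp M) (vsval g \o f)%VF.

Lemma precompE M N (f : rhom M N) g x :
  vsval (precomp_fun f g) x = vsval g (f x).
Proof.
rewrite vsprojK ?comp_lfunE //; apply/homA_spP => y a.
have /homA_spP hg := subvsP g.
by rewrite !comp_lfunE rhomP hg.
Qed.

Fact precomp_linear M N (f : rhom M N) : linear (precomp_fun f).
Proof.
move=> k g h; apply: subvs_inj; apply/lfunP => x.
rewrite precompE !(linearP (@vsval _ _ (homA_sp _))) /=.
by rewrite !add_lfunE !scale_lfunE !precompE.
Qed.
HB.instance Definition _ M N (f : rhom M N) :=
  GRing.isLinear.Build K (homA N) (homA M) _ (precomp_fun f) (precomp_linear f).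

Fact precomp_subproof M N (f : rhom M N) (g : homA N) a :
  linfun (precomp_fun f) (g ** a) = linfun (precomp_fun f) g ** a.
Proof.
rewrite !lfunE /=; apply: subvs_inj; apply/lfunP => x.
by rewrite precompE [LHS]homA_actE [RHS]homA_actE precompE.
Qed.

Definition precomp M N (f : rhom M N) : rhom (homA N) (homA M) :=
  RHom (precomp_subproof f).

Definition cocycles M (R : projres M) i : submod (homA (R i)) :=
  ker_mod (precomp (pr_d R i)).

Definition coboundaries M (R : projres M) i : submod (homA (R i)) :=
  if i is j.+1 then im_mod (precomp (pr_d R j)) else zero_sub (homA (R 0%N)).

Definition ExtA_of M (R : projres M) i : lmod A :=
  subquo_mod (cocycles R i) (coboundaries R i).

(* Ext^i_A(M, A), computed from the free resolution whose i-th term has rank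
   the K-dimension of the i-th syzygy.                                        *)
Definition ExtA i M : lmod A := ExtA_of (free_res M) i.

End ExtA.

(* D = Hom_K(-, K), (f a)(x) = f(a x). *)
Section DualK.
Variables (K : fieldType) (A : falgType K) (M : lmod A).

Definition dual_act (f : 'Hom(M, K^o)) (a : A) : 'Hom(M, K^o) :=
  (f \o mactf M a)%VF.

Lemma dual_actE f a x : dual_act f a x = f (x ** a).
Proof. by rewrite comp_lfunE mactfE. Qed.

Fact dual_linl a : linear (dual_act^~ a).
Proof.
move=> k f g; apply/lfunP => x.
by rewrite dual_actE !add_lfunE !scale_lfunE !dual_actE.
Qed.
Fact dual_linr f : linear (dual_act f).
Proof.
move=> k a b; apply/lfunP => x.
by rewrite add_lfunE scale_lfunE !dual_actE mactPr linearP.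
Qed.
Fact dual_act1 f : dual_act f 1 = f.
Proof. by apply/lfunP => x; rewrite dual_actE mact1. Qed.
Fact dual_actM f a b : dual_act f (a * b) = dual_act (dual_act f a) b.
Proof. by apply/lfunP => x; rewrite !dual_actE -mactM. Qed.

Definition dual : rmod A :=
  @Module Rgt K A _ _ dual_linl dual_linr dual_act1 dual_actM.

End DualK.

Section AuslanderGorenstein.
Variables (K : fieldType) (A : falgType K).

Definition Auslander_Gorenstein : Prop :=
  (exists R : injcores (reg A),
     minimal_injcores R /\ forall i, pdim_le (R i) i) /\
  exists n, idim_le (reg A) n.

Definition has_grade (S : rmod A) (g : nat) : Prop :=
  ~ zero_mod (ExtA g S) /\ forall i, (i < g)%N -> zero_mod (ExtA i S).

(* The graph of the grade bijection on isomorphism classes: T is isomorphic to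
   top (D Ext^g(S, A)), g being the grade of S.                               *)
Definition grade_bij (S T : rmod A) : Prop :=
  exists2 g, has_grade S g & iso T (top (dual (ExtA g S))).

End AuslanderGorenstein.

(* Main.v *)
(* Write S = soc I and g = grade S; Ext^k (S, -) vanishes on projectives for
   k < g.  The local top of D Ext^g (S, A) provides a class u in Ext^g (S, P)
   that survives only under split monomorphisms from P to projectives.  Through
   the minimal injective coresolution of P it becomes an embedding of S in the
   g-th cosyzygy X of P.  The same construction in the coresolution of A makes I
   a retract of its g-th term, so pdim I <= g, and pdim I >= g by dimension
   shifting; hence r = g.

   Extend the inclusion of S in I to X -> I, and let Q be the last term of the
   minimal projective resolution of I.  Since the i-th term of the coresolution
   of A has projective dimension at most i, X -> I lifts to a map h : P -> Q, and
   h u <> 0 because Hom (S, I) embeds in Ext^g (S, Q).  So h is a split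
   monomorphism, and a retraction of h induces I -> X with X -> I -> X equal to
   the identity modulo maps that factor through the preceding injective; by
   minimality such maps are not injective on any nonzero submodule, so X is a
   summand of I, whence X = I.  Minimality of the projective resolution then
   makes h an isomorphism. *)

From HB Require Import structures.
From mathcomp Require Import all_boot all_order all_algebra all_field.
From mathcomp Require Import boolp.
Require Import Defs.

Set Implicit Arguments.
Unset Strict Implicit.
Unset Printing Implicit Defensive.

Import GRing.Theory.
Local Open Scope ring_scope.

(** * Homomorphisms, factorization and Fitting's lemma *)

Section Maps.
Variables (s : side) (K : fieldType) (A : falgType K).
Implicit Types M N L : module s A.

Definition inj M N (f : rhom M N) : Prop := forall x, f x = 0 -> x = 0.
Definition surj M N (f : rhom M N) : Prop := forall y, exists x, f x = y.

Lemma lker_inj M N (f : rhom M N) : lker f = 0%VS <-> inj f.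
Proof.
split=> [f0 x fx0|injf].
  by apply/eqP; rewrite -memv0 -f0 memv_ker fx0.
by apply/vspaceP=> x; rewrite memv_ker memv0; apply/eqP/eqP => [/injf|->//];
  rewrite ?linear0.
Qed.

Lemma limg_surj M N (f : rhom M N) : limg f = fullv <-> surj f.
Proof.
split=> [fT y|surjf].
  have /memv_imgP[x _ ->] : y \in limg f by rewrite fT memvf.
  by exists x.
apply/vspaceP=> y; rewrite memvf; have [x <-] := surjf y.
by rewrite memv_img ?memvf.
Qed.

Lemma zero_modP M : zero_mod M <-> forall x : M, x = 0.
Proof.
split=> [/eqP|M0].
  by rewrite dimv_eq0 => /eqP M0 x; apply/eqP; rewrite -memv0 -M0 memvf.
by apply/eqP; rewrite dimv_eq0 -subv0; apply/subvP=> x _; rewrite (M0 x) mem0v.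
Qed.

Lemma nonzero_ex M : ~ zero_mod M -> exists x : M, x <> 0.
Proof.
move=> nM; apply: contrapT => h; apply/nM/zero_modP => x.
by apply: contrapT => x0; apply: h; exists x.
Qed.

Lemma inj_eq M N (f : rhom M N) x y : inj f -> f x = f y -> x = y.
Proof.
move=> injf fxy; apply/eqP; rewrite -subr_eq0; apply/eqP/injf.
by rewrite linearB /= fxy subrr.
Qed.

Lemma rhom_ex M N (f : M -> N) : linear f -> (forall x a, f (x ** a) = f x ** a) ->
  exists g : rhom M N, forall x, g x = f x.
Proof.
move=> lf fact.
pose lm := GRing.isLinear.Build K M N *:%R f lf.
pose f' : {linear M -> N} := HB.pack f lm.
have fE x : linfun f' x = f x by rewrite lfunE.
have ract x a : linfun f' (x ** a) = linfun f' x ** a by rewrite !fE.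
by exists (RHom ract).
Qed.

Fact rid_subproof M (x : M) (a : A) : (\1%VF : 'End(M)) (x ** a) = \1%VF x ** a.
Proof. by rewrite !id_lfunE. Qed.
Definition rid M : rhom M M := RHom (@rid_subproof M).

Lemma ridE M (x : M) : rid M x = x. Proof. exact: id_lfunE. Qed.

Fact rzero_subproof M N (x : M) (a : A) :
  (0 : 'Hom(M, N)) (x ** a) = (0 : 'Hom(M, N)) x ** a.
Proof. by rewrite !zero_lfunE mact0l. Qed.
Definition rzero M N : rhom M N := RHom (@rzero_subproof M N).

Lemma rzeroE M N (x : M) : rzero M N x = 0. Proof. exact: zero_lfunE. Qed.

Fact rsub_subproof M N (f g : rhom M N) x a :
  (rhom_fun f - rhom_fun g) (x ** a) = (rhom_fun f - rhom_fun g) x ** a.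
Proof. by rewrite !add_lfunE !opp_lfunE !rhomP mactBl. Qed.
Definition rsub M N (f g : rhom M N) : rhom M N := RHom (rsub_subproof f g).

Lemma rsubE M N (f g : rhom M N) x : rsub f g x = f x - g x.
Proof. by rewrite add_lfunE opp_lfunE. Qed.

Lemma rcompE M N L (g : rhom N L) (f : rhom M N) x : rhom_comp g f x = g (f x).
Proof. exact: comp_lfunE. Qed.

Lemma inclE M (U : submod M) (x : sub_mod U) : incl U x = vsval x.
Proof. exact: lfunE. Qed.

Lemma incl_inj M (U : submod M) : inj (incl U).
Proof. by move=> x; rewrite inclE => x0; apply: subvs_inj; rewrite x0 linear0. Qed.

Lemma incl_mem M (U : submod M) (x : sub_mod U) : incl U x \in (U : {vspace M}).
Proof. by rewrite inclE subvsP. Qed.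

Lemma incl_ex M (U : submod M) x : x \in (U : {vspace M}) -> exists y, incl U y = x.
Proof. by move=> xU; exists (vsproj U x); rewrite inclE vsprojK. Qed.

Lemma quo_rhom M (U : submod M) : exists q : rhom M (quo_mod U),
  surj q /\ forall x, q x = 0 <-> x \in (U : {vspace M}).
Proof.
have ql : linear (quo_proj U : M -> quo_mod U) by exact: quo_proj_linear.
have qa x a : (quo_proj U : M -> quo_mod U) (x ** a) = (quo_proj U x : quo_mod U) ** a.
  by rewrite -quo_actE.
have [q qE] := rhom_ex ql qa; exists q; split=> [y|x].
  by exists (vsval (y : subvs_of _)); rewrite qE quo_projK.
by rewrite qE -quo_proj_eq0; split=> [->|/eqP//].
Qed.

(** The linear pseudo-inverse of [g] is a section of [g]; since [f] kills the kernel of [g],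
    following it by [f] does not depend on the section, which yields [A]-linearity. *)
Lemma factor_surj M N L (g : rhom M N) (f : rhom M L) : surj g ->
    (forall x, g x = 0 -> f x = 0) ->
  exists h : rhom N L, forall x, h (g x) = f x.
Proof.
move=> sg gf; have hE x : f ((g^-1)%VF (g x)) = f x.
  apply/eqP; rewrite -subr_eq0 -linearB /=; apply/eqP/gf.
  by rewrite linearB /= limg_lfunVK ?subrr ?memv_img ?memvf.
have [|y a|h hh] := @rhom_ex N L (fun y => f ((g^-1)%VF y)).
- by move=> k y z; rewrite !linearP.
- by have [x <-] := sg y; rewrite hE -!rhomP hE.
by exists h => x; rewrite hh.
Qed.

Lemma factor_inj M N L (g : rhom N L) (f : rhom M L) : inj g ->
    (forall x, exists y, g y = f x) ->
  exists h : rhom M N, forall x, g (h x) = f x.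
Proof.
move=> ig gf; have hE x : g ((g^-1)%VF (f x)) = f x.
  have [y <-] := gf x; by rewrite limg_lfunVK ?memv_img ?memvf.
have [|y a|h hh] := @rhom_ex M N (fun y => (g^-1)%VF (f y)).
- by move=> k y z; rewrite !linearP.
- by apply: (inj_eq ig); rewrite hE !rhomP hE.
by exists h => x; rewrite hh.
Qed.

Lemma inv_rhom M N (f : rhom M N) : inj f -> surj f ->
  exists g : rhom N M, (forall x, g (f x) = x) /\ forall y, f (g y) = y.
Proof.
move=> fi fs; have [x|g fg] := factor_inj (f := rid N) fi.
  by have [y <-] := fs x; exists y; rewrite ridE.
have fg' y : f (g y) = y by rewrite fg ridE.
by exists g; split=> // x; apply: (inj_eq fi).
Qed.

Lemma inj_surj M N (f : rhom M N) : inj f -> (\dim {:N} <= \dim {:M})%N -> surj f.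
Proof.
move=> /lker_inj f0 le; apply/limg_surj/eqP; rewrite eqEdim subvf /=.
by rewrite (limg_dim_eq (f := f) (U := fullv)) ?f0 ?capv0.
Qed.

Lemma surj_inj M N (f : rhom M N) : surj f -> (\dim {:M} <= \dim {:N})%N -> inj f.
Proof.
move=> /limg_surj fT le; apply/lker_inj/eqP; rewrite -dimv_eq0 -leqn0.
have := limg_ker_dim f fullv; rewrite fT capfv => e.
by rewrite -(leq_add2r (\dim {:N})) e add0n.
Qed.

(** Elementwise form of [essential (limg f)], free of intersections of subspaces. *)
Definition essentialr M N (f : rhom M N) : Prop :=
  forall W : submod N, (forall x, f x \in (W : {vspace N}) -> f x = 0) ->
    forall y, y \in (W : {vspace N}) -> y = 0.

Lemma essentialP M N (f : rhom M N) : essential (limg f) -> essentialr f.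
Proof.
move=> ef W fW y; rewrite (ef W); first by rewrite memv0 => /eqP.
apply/eqP; rewrite -subv0; apply/subvP => z /memv_capP[/memv_imgP[x _ ->] xW].
by rewrite fW // mem0v.
Qed.

Lemma essentialr_limg M N (f : rhom M N) : essentialr f -> essential (limg f).
Proof.
move=> ef W fW; apply/eqP; rewrite -subv0; apply/subvP => y yW.
suff -> : y = 0 by exact: mem0v.
apply: ef yW => x xW; apply/eqP; rewrite -memv0 -fW memv_cap xW.
by rewrite memv_img ?memvf.
Qed.

(** A submodule [W] together with the kernel spans [M] exactly when [W] already has the full image
    of [f]; superfluity of the kernel is tested in this form. *)
Definition superfluousr M N (f : rhom M N) : Prop :=
  forall W : submod M, (forall x, exists2 w, w \in (W : {vspace M}) & f w = f x) ->
    forall x, x \in (W : {vspace M}).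

Lemma superfluousP M N (f : rhom M N) : superfluous (lker f) -> superfluousr f.
Proof.
move=> sf W fW x; suff -> : (W : {vspace M}) = fullv by exact: memvf.
apply: sf; apply/vspaceP=> y; rewrite memvf; have [w wW e] := fW y.
have -> : y = (y - w) + w by rewrite subrK.
by rewrite memv_add // memv_ker linearB /= e subrr.
Qed.

Lemma superfluousr_lker M N (f : rhom M N) : superfluousr f -> superfluous (lker f).
Proof.
move=> sf W fW; apply/vspaceP=> x; rewrite memvf sf // => y.
have /memv_addP[k kf [w wW ->]] : y \in (lker f + W)%VS by rewrite fW memvf.
by exists w => //; move: kf; rewrite memv_ker linearD /= => /eqP->; rewrite add0r.
Qed.

Lemma projective_lift P M N (g : rhom M N) (f : rhom P N) : projective P -> surj g ->
  exists h : rhom P M, forall x, g (h x) = f x.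
Proof. by move=> pP /limg_surj; exact: pP. Qed.

Lemma injective_extend I M N (g : rhom M N) (f : rhom M I) : injective_mod I -> inj g ->
  exists h : rhom N I, forall x, h (g x) = f x.
Proof. by move=> iI /lker_inj; exact: iI. Qed.

Lemma retract_projective M N (i : rhom N M) (r : rhom M N) :
  (forall x, r (i x) = x) -> projective M -> projective N.
Proof.
move=> ri pM X Y g f sg; have [h hh] := pM _ _ g (rhom_comp f r) sg.
by exists (rhom_comp h i) => x; rewrite rcompE hh rcompE ri.
Qed.

Lemma retract_injective M N (i : rhom N M) (r : rhom M N) :
  (forall x, r (i x) = x) -> injective_mod M -> injective_mod N.
Proof.
move=> ri iM X Y g f ig; have [h hh] := iM _ _ g (rhom_comp i f) ig.
by exists (rhom_comp r h) => x; rewrite rcompE hh rcompE ri.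
Qed.

Lemma im_corestr M N (f : rhom M N) : exists g : rhom M (sub_mod (im_mod f)),
  surj g /\ forall x, incl (im_mod f) (g x) = f x.
Proof.
have [x|g gE] := factor_inj (f := f) (incl_inj (U := im_mod f)).
  by apply: incl_ex; exact/memv_img/memvf.
exists g; split=> // y; have := incl_mem y => /memv_imgP[x _ e].
by exists x; apply: (inj_eq (incl_inj (U := im_mod f))); rewrite gE e.
Qed.

Lemma zero_rhom M N (f : rhom M N) x : zero_mod M -> f x = 0.
Proof. by move=> /zero_modP M0; rewrite (M0 x) linear0. Qed.

Lemma iso_of M N (f : rhom M N) : inj f -> surj f -> iso M N.
Proof. by move=> /lker_inj fi /limg_surj fs; exists f. Qed.

Lemma iso_rhom M N : iso M N -> exists f : rhom M N, inj f /\ surj f.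
Proof. by case=> f [/lker_inj fi /limg_surj fs]; exists f. Qed.

Lemma rker_mem M N (f : rhom M N) x : x \in (ker_mod f : {vspace M}) <-> f x = 0.
Proof. by rewrite memv_ker; split=> [/eqP|->]. Qed.

Lemma rim_mem M N (f : rhom M N) y : y \in (im_mod f : {vspace N}) <-> exists x, f x = y.
Proof.
by split=> [/memv_imgP[x _ ->]|[x <-]]; [exists x | exact/memv_img/memvf].
Qed.

Fixpoint riter M (f : rhom M M) n : rhom M M :=
  if n is n'.+1 then rhom_comp f (riter f n') else rid M.

Lemma riterE M (f : rhom M M) n x : riter f n x = iter n f x.
Proof. by elim: n => [|n IHn] /=; rewrite ?ridE ?rcompE ?IHn. Qed.

(** For an iterate whose image has least dimension, [g] and its square have the same image; hence
    kernel and image of [g] span [M], and a dimension count makes the sum direct. The exponent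
    [n.+1] is positive so that [g] kills the kernel of [f]. *)
Lemma fitting M (f : rhom M M) : exists n,
  let g := riter f n.+1 in
  (forall x, exists y, g (x - g y) = 0) /\ (forall x, g (g x) = 0 -> g x = 0).
Proof.
pose d n := \dim (limg (riter f n.+1)).
have [n minn] : exists n, forall m, (d n <= d m)%N.
  have ex : exists k, [pred k | `[< exists n, d n = k >]] k.
    by exists (d 0%N); apply/asboolP; exists 0%N.
  case: (ex_minnP ex) => _ /asboolP[n <-] h; exists n => m.
  by apply: h; apply/asboolP; exists m.
exists n; set g := riter f n.+1 => /=.
have gg x : g (g x) = riter f (n + n.+1).+1 x.
  by rewrite !riterE -iterD addSn.
have limgg : limg (riter f (n + n.+1).+1) = limg g.
  apply/eqP; rewrite eqEdim minn andbT; apply/subvP => _ /memv_imgP[x _ ->].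
  by rewrite -gg memv_img ?memvf.
have ex x : exists y, g (x - g y) = 0.
  have : g x \in limg g by rewrite memv_img ?memvf.
  rewrite -limgg => /memv_imgP[y _ e]; exists y.
  by rewrite linearB /= e gg subrr.
split=> // x gx.
have sumT : (lker g + limg g)%VS = fullv.
  apply/vspaceP=> y; rewrite memvf; have [z e] := ex y.
  by rewrite -[y](subrK (g z)) memv_add ?memv_ker ?e // memv_img ?memvf.
have := dimv_sum_cap (lker g) (limg g); rewrite sumT.
have := limg_ker_dim g fullv; rewrite capfv => e; rewrite -e.
move/eqP; rewrite -[X in _ == X]addn0 eqn_add2l dimv_eq0 => /eqP cap0.
by apply/eqP; rewrite -memv0 -cap0 memv_cap memv_ker gx eqxx memv_img ?memvf.
Qed.

(** One of the two Fitting summands is zero: if the kernel, [f] is injective; if the image, [f] is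
    nilpotent. *)
Lemma indecomposable_endo M (f : rhom M M) : indecomposable M ->
  inj f \/ exists n, forall x, riter f n x = 0.
Proof.
case=> _ indM; have [n [split_ cap_]] := fitting f.
set g := riter f n.+1 in split_ cap_.
case: (indM (ker_mod g) (im_mod g)).
- apply/vspaceP=> x; rewrite memvf; have [y /rker_mem e] := split_ x.
  have -> : x = (x - g y) + g y by rewrite subrK.
  by rewrite memv_add // memv_img ?memvf.
- apply/eqP; rewrite -subv0; apply/subvP=> x /memv_capP[/rker_mem gx /rim_mem[y e]].
  by rewrite -e cap_ ?mem0v // e gx.
- move=> /lker_inj gi; left=> x fx; apply: gi.
  by rewrite riterE iterSr fx -riterE linear0.
- move=> g0; right; exists n.+1 => x; apply/eqP; rewrite -memv0 -g0.
  by rewrite memv_img ?memvf.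
Qed.

End Maps.

(** * Morphisms of exact sequences *)

Section Ladders.
Variables (s : side) (K : fieldType) (A : falgType K).
Implicit Types M N L : module s A.

Definition ses M N L (f : rhom M N) (g : rhom N L) : Prop :=
  [/\ inj f, surj g & forall x, g x = 0 <-> exists y, f y = x].

Record ext1 M := Ext1 {
  e_mid : module s A;
  e_end : module s A;
  e_in : rhom M e_mid;
  e_out : rhom e_mid e_end;
  e_ses : ses e_in e_out }.

(* Exact sequences 0 -> M -> E_1 -> ... -> E_n -> N -> 0, cut into short exact
   sequences; for n = 0, isomorphisms M -> N. *)
Fixpoint yext n M N : Type :=
  if n is n'.+1 then {x : ext1 M & yext n' (e_end x) N}
  else {f : rhom M N | inj f /\ surj f}.

Definition mid n M N (E : yext n.+1 M N) : module s A := e_mid (projT1 E).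
Definition tl n M N (E : yext n.+1 M N) : module s A := e_end (projT1 E).
Definition yin n M N (E : yext n.+1 M N) : rhom M (mid E) := e_in (projT1 E).
Definition yout n M N (E : yext n.+1 M N) : rhom (mid E) (tl E) := e_out (projT1 E).
Definition ytl n M N (E : yext n.+1 M N) : yext n (tl E) N := projT2 E.

Lemma yses n M N (E : yext n.+1 M N) : ses (yin E) (yout E).
Proof. exact: e_ses. Qed.

(** The intermediate vertical maps are hidden by existentials, so that morphisms of exact sequences
    compose and subtract as pairs of end maps. *)
Fixpoint ladder n : forall M N M' N', yext n M N -> yext n M' N' ->
    rhom M M' -> rhom N N' -> Prop :=
  match n with
  | 0 => fun M N M' N' E E' a c => forall x, c (sval E x) = sval E' (a x)
  | n'.+1 => fun M N M' N' E E' a c =>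
      exists (b : rhom (mid E) (mid E')) (a1 : rhom (tl E) (tl E')),
      [/\ forall x, b (yin E x) = yin E' (a x),
          forall x, a1 (yout E x) = yout E' (b x)
        & ladder (ytl E) (ytl E') a1 c]
  end.

Lemma ladder_comp n M N M' N' M'' N'' (E : yext n M N) (E' : yext n M' N')
    (E'' : yext n M'' N'')
    (a : rhom M M') (c : rhom N N') (a' : rhom M' M'') (c' : rhom N' N'') :
  ladder E E' a c -> ladder E' E'' a' c' ->
  ladder E E'' (rhom_comp a' a) (rhom_comp c' c).
Proof.
elim: n M N M' N' M'' N'' E E' E'' a c a' c' =>
    [|n IHn] M N M' N' M'' N'' E E' E'' a c a' c' /=.
  by move=> h h' x; rewrite !rcompE h h'.
move=> [b [a1 [h1 h2 h3]]] [b' [a1' [h1' h2' h3']]].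
exists (rhom_comp b' b), (rhom_comp a1' a1); split=> [x|x|].
- by rewrite !rcompE h1 h1'.
- by rewrite !rcompE h2 h2'.
- exact: IHn h3 h3'.
Qed.

Lemma ladder_sub n M N M' N' (E : yext n M N) (E' : yext n M' N')
    (a a' : rhom M M') (c c' : rhom N N') :
  ladder E E' a c -> ladder E E' a' c' -> ladder E E' (rsub a a') (rsub c c').
Proof.
elim: n M N M' N' E E' a c a' c' => [|n IHn] M N M' N' E E' a c a' c' /=.
  by move=> h h' x; rewrite !rsubE h h' linearB.
move=> [b [a1 [h1 h2 h3]]] [b' [a1' [h1' h2' h3']]].
exists (rsub b b'), (rsub a1 a1'); split=> [x|x|].
- by rewrite !rsubE h1 h1' linearB.
- by rewrite !rsubE h2 h2' linearB.
- exact: IHn h3 h3'.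
Qed.

Lemma ladder_id n M N (E : yext n M N) : ladder E E (rid M) (rid N).
Proof.
elim: n M N E => [|n IHn] M N E /=; first by move=> x; rewrite !ridE.
by exists (rid _), (rid _); split=> [x|x|] //; rewrite !ridE.
Qed.

Fixpoint all_mid (C : module s A -> Prop) n : forall M N, yext n M N -> Prop :=
  match n with
  | 0 => fun _ _ _ => True
  | n'.+1 => fun M N E => C (mid E) /\ all_mid C (ytl E)
  end.

Lemma ladder_forward n M N M' N' (E : yext n M N) (E' : yext n M' N') (a : rhom M M') :
  all_mid (@injective_mod s K A) E' -> exists c, ladder E E' a c.
Proof.
elim: n M N M' N' E E' a => [|n IHn] M N M' N' E E' a /=.
  move=> _; case: E => f [fi fs].
  have [|c hc] := factor_surj (f := rhom_comp (sval E') a) fs; last first.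
    by exists c => x /=; rewrite hc rcompE.
  by move=> x /fi ->; rewrite linear0.
move=> [iE' /IHn{}IHn]; have [iE sE eE] := yses E; have [iE1 sE1 eE1] := yses E'.
have [b hb] := injective_extend (rhom_comp (yin E') a) iE' iE.
have [|a1 ha1] := factor_surj (f := rhom_comp (yout E') b) sE.
  move=> x /eE[y <-]; rewrite rcompE hb rcompE; apply/eE1; by exists (a y).
have [c hc] := IHn _ _ (ytl E) a1.
exists c, b, a1; split=> // x; first by rewrite hb rcompE.
by rewrite ha1 rcompE.
Qed.

(** Weaker than projectivity of the middle terms of [E]: when [E'] is cut from an injective
    coresolution, it is enough that the [i]-th middle term of [E], counted from 0, has projective
    dimension at most [i]. *)
Fixpoint lift_cond n : forall M N M' N', yext n M N -> yext n M' N' -> Prop :=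
  match n with
  | 0 => fun _ _ _ _ _ _ => True
  | n'.+1 => fun M N M' N' E E' =>
      (forall f : rhom (mid E) (tl E'),
        exists g : rhom (mid E) (mid E'), forall x, yout E' (g x) = f x)
      /\ lift_cond (ytl E) (ytl E')
  end.

Lemma projective_lift_cond n M N M' N' (E : yext n M N) (E' : yext n M' N') :
  all_mid (@projective s K A) E -> lift_cond E E'.
Proof.
elim: n M N M' N' E E' => [//|n IHn] M N M' N' E E' /= [pE /IHn h]; split=> // f.
by have [_ sE _] := yses E'; exact: projective_lift.
Qed.

Lemma ladder_backward n M N M' N' (E : yext n M N) (E' : yext n M' N') (c : rhom N N') :
  lift_cond E E' -> exists a, ladder E E' a c.
Proof.
elim: n M N M' N' E E' c => [|n IHn] M N M' N' E E' c /=.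
  move=> _; case: E' => f [fi fs].
  have [|a ha] := factor_inj (f := rhom_comp c (sval E)) fi; last first.
    by exists a => x /=; rewrite ha rcompE.
  by move=> x; exact: fs.
move=> [lE /IHn{}IHn]; have [iE sE eE] := yses E; have [iE1 sE1 eE1] := yses E'.
have [a1 ha1] := IHn c; have [b hb] := lE (rhom_comp a1 (yout E)).
have [|a ha] := factor_inj (f := rhom_comp b (yin E)) iE1.
  move=> x; apply/eE1; rewrite rcompE hb rcompE.
  by have -> : yout E (yin E x) = 0; [apply/eE; exists x | rewrite linear0].
exists a, b, a1; split=> // x; first by rewrite ha rcompE.
by rewrite hb rcompE.
Qed.

(* When E is a truncated projective resolution of N, this says that the class of
   a in Ext^n (N, L) vanishes. *)
Definition extends n M N (E : yext n M N) L (a : rhom M L) : Prop :=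
  match n return yext n M N -> Prop with
  | 0 => fun _ => forall x, a x = 0
  | n'.+1 => fun E => exists t : rhom (mid E) L, forall x, t (yin E x) = a x
  end E.

(** The recursion walks to the right end of [E] and carries along the map [p] out of the middle term
    just passed; at the end [B] is the last middle term. *)
Fixpoint lifts_from n : forall M N, yext n M N ->
    forall L B, rhom B M -> rhom L N -> Prop :=
  match n with
  | 0 => fun M N E L B p c => exists t : rhom L B, forall x, sval E (p (t x)) = c x
  | n'.+1 => fun M N E L B p c => lifts_from (ytl E) (yout E) c
  end.

(* c : L -> N lifts to the last middle term of E; for n = 0, c = 0. *)
Definition lifts n M N (E : yext n M N) L (c : rhom L N) : Prop :=
  match n return yext n M N -> Prop with
  | 0 => fun _ => forall x, c x = 0
  | n'.+1 => fun E => lifts_from (ytl E) (yout E) c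
  end E.

(** [B] stands for the middle term just to the left of [E']. The condition is what moves a
    null-homotopy one square to the right; it follows from injectivity of the targets or from
    vanishing of Ext groups. *)
Fixpoint ext_cond n : forall M N M' N', yext n M N -> yext n M' N' ->
    module s A -> Prop :=
  match n with
  | 0 => fun _ _ _ _ _ _ _ => True
  | n'.+1 => fun M N M' N' E E' B =>
      (forall f : rhom M B,
        exists g : rhom (mid E) B, forall x, g (yin E x) = f x)
      /\ ext_cond (ytl E) (ytl E') (mid E')
  end.

Lemma injective_ext_cond n M N M' N' (E : yext n M N) (E' : yext n M' N') B :
  injective_mod B -> all_mid (@injective_mod s K A) E' -> ext_cond E E' B.
Proof.
elim: n M N M' N' E E' B => [//|n IHn] M N M' N' E E' B /= iB [iE' /IHn h].
by split; [move=> f; have [iE _ _] := yses E; exact: injective_extend | exact: h].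
Qed.

(** The difference [b - f' t] vanishes on the image of [f], so it descends to [N]; it lifts [c]
    because [g' f' = 0]. *)
Lemma square_homotopy M B N M' B' N' (f : rhom M B) (g : rhom B N)
    (f' : rhom M' B') (g' : rhom B' N')
    (a : rhom M M') (b : rhom B B') (c : rhom N N') (t : rhom B M') :
  ses f g -> ses f' g' ->
  (forall x, b (f x) = f' (a x)) -> (forall x, c (g x) = g' (b x)) ->
  (forall x, t (f x) = a x) ->
  exists u : rhom N B', forall x, g' (u x) = c x.
Proof.
move=> [fi gs eg] [fi' gs' eg'] hb hc ht.
have [|u hu] := factor_surj (f := rsub b (rhom_comp f' t)) gs.
  by move=> x /eg[y <-]; rewrite rsubE rcompE ht hb subrr.
exists u => y; have [x <-] := gs y; rewrite hu rsubE linearB /= hc rcompE.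
by have -> : g' (f' (t x)) = 0; [apply/eg'; exists (t x) | rewrite subr0].
Qed.

(** Dually, [b - u g] has its values in the kernel of [g'], that is, in the image of [f']. *)
Lemma square_homotopy_inv M B N M' B' N' (f : rhom M B) (g : rhom B N)
    (f' : rhom M' B') (g' : rhom B' N')
    (a : rhom M M') (b : rhom B B') (c : rhom N N') (u : rhom N B') :
  ses f g -> ses f' g' ->
  (forall x, b (f x) = f' (a x)) -> (forall x, c (g x) = g' (b x)) ->
  (forall x, g' (u x) = c x) ->
  exists t : rhom B M', forall x, t (f x) = a x.
Proof.
move=> [fi gs eg] [fi' gs' eg'] hb hc hu.
have [|t ht] := factor_inj (f := rsub b (rhom_comp u g)) fi'.
  by move=> x; apply/eg'; rewrite rsubE linearB /= rcompE hu hc subrr.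
exists t => x; apply: (inj_eq fi'); rewrite ht rsubE rcompE hb.
by have -> : g (f x) = 0; [apply/eg; exists x | rewrite linear0 subr0].
Qed.

(** Extending [t] over the first middle term gives a null-homotopy of the first square;
    [square_homotopy] turns it into a factorization of the next vertical map through [yout E'], and
    the induction goes on from there. *)
Lemma lifts_of_factor n M N M' N' (E : yext n M N) (E' : yext n M' N')
    (a : rhom M M') (c : rhom N N') B (p : rhom B M') (t : rhom M B) :
  ladder E E' a c -> ext_cond E E' B -> (forall x, p (t x) = a x) ->
  lifts_from E' p c.
Proof.
elim: n M N M' N' E E' a c B p t => [|n IHn] M N M' N' E E' a c B p t /=.
  move=> h _ pt; case: E h => f [fi fs] /= h.
  have [|t1 ht1] := factor_surj (f := t) fs; first by move=> x /fi ->; rewrite linear0.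
  by exists t1 => y; have [x <-] := fs y; rewrite ht1 pt h.
move=> [b [a1 [hb ha1 h]]] [ex exE] pt; have [t1 ht1] := ex t.
have ht x : rhom_comp p t1 (yin E x) = a x by rewrite rcompE ht1 pt.
have [u hu] := square_homotopy (yses E) (yses E') hb ha1 ht.
exact: IHn h exE hu.
Qed.

(** A null-homotopy is propagated from left to right. For [E] with projective and [E'] with
    injective middle terms, this and [extends_of_lifts] show that the two end maps detect the
    vanishing of the same class in Ext^n. *)
Lemma lifts_of_extends n M N M' N' (E : yext n M N) (E' : yext n M' N')
    (a : rhom M M') (c : rhom N N') :
  ladder E E' a c -> extends E a ->
  match n return yext n M N -> yext n M' N' -> Prop with
  | 0 => fun _ _ => True
  | n'.+1 => fun E E' => ext_cond (ytl E) (ytl E') (mid E')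
  end E E' ->
  lifts E' c.
Proof.
case: n E E' => [|n] E E' /=.
  move=> h a0 _ y; have [_ fs] := svalP E.
  by have [x <-] := fs y; rewrite h a0 linear0.
move=> [b [a1 [hb ha1 h]]] [t ht] exE.
have [u hu] := square_homotopy (yses E) (yses E') hb ha1 ht.
exact: lifts_of_factor h exE hu.
Qed.

(** The null-homotopy is propagated from right to left, projectivity lifting it through [p] at each
    square. *)
Lemma factor_of_lifts n M N M' N' (E : yext n M N) (E' : yext n M' N')
    (a : rhom M M') (c : rhom N N') B (p : rhom B M') :
  ladder E E' a c -> all_mid (@projective s K A) E -> surj p -> lifts_from E' p c ->
  exists t : rhom M B, forall x, p (t x) = a x.
Proof.
elim: n M N M' N' E E' a c B p => [|n IHn] M N M' N' E E' a c B p /=.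
  move=> h _ _ [t ht]; exists (rhom_comp t (sval E)) => x.
  by have [fi _] := svalP E'; apply: (inj_eq fi); rewrite rcompE ht h.
move=> [b [a1 [hb ha1 h]]] [pE pE1] sp li; have [_ sE _] := yses E'.
have [u hu] := IHn _ _ _ _ _ _ _ _ _ _ h pE1 sE li.
have [t ht] := square_homotopy_inv (yses E) (yses E') hb ha1 hu.
have [t1 ht1] := projective_lift t pE sp.
by exists (rhom_comp t1 (yin E)) => x; rewrite rcompE ht1 ht.
Qed.

Lemma extends_of_lifts n M N M' N' (E : yext n M N) (E' : yext n M' N')
    (a : rhom M M') (c : rhom N N') :
  ladder E E' a c -> all_mid (@projective s K A) E -> lifts E' c -> extends E a.
Proof.
case: n E E' => [|n] E E' /=.
  by move=> h _ c0 x; have [fi _] := svalP E'; apply: fi; rewrite -h c0.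
move=> [b [a1 [hb ha1 h]]] [pE pE1] li; have [_ sE _] := yses E'.
have [u hu] := factor_of_lifts h pE1 sE li.
exact: square_homotopy_inv (yses E) (yses E') hb ha1 hu.
Qed.

Lemma extends_comp n M N (E : yext n M N) L L' (a : rhom M L) (k : rhom L L') :
  extends E a -> extends E (rhom_comp k a).
Proof.
case: n E => [|n] E /=; first by move=> a0 x; rewrite rcompE a0 linear0.
by move=> [t ht]; exists (rhom_comp k t) => x; rewrite !rcompE ht.
Qed.

Lemma extends_eq n M N (E : yext n M N) L (a b : rhom M L) :
  (forall x, a x = b x) -> extends E a -> extends E b.
Proof.
case: n E => [|n] E /= ab; first by move=> a0 x; rewrite -ab.
by move=> [t ht]; exists t => x; rewrite ht.
Qed.

(** Only exactness is recorded: [cZ] are the syzygies of a resolution with terms [cQ], and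
    projectivity is assumed separately where it matters. *)
Record chain := Chain {
  cZ : nat -> module s A;
  cQ : nat -> module s A;
  ce : forall i, rhom (cZ i.+1) (cQ i);
  cp : forall i, rhom (cQ i) (cZ i);
  cses : forall i, ses (ce i) (cp i) }.

Record cochain := Cochain {
  dY : nat -> module s A;
  dJ : nat -> module s A;
  de : forall i, rhom (dY i) (dJ i);
  dp : forall i, rhom (dJ i) (dY i.+1);
  dses : forall i, ses (de i) (dp i) }.

Definition tail (D : cochain) : cochain :=
  @Cochain (fun i => dY D i.+1) (fun i => dJ D i.+1) (fun i => de D i.+1)
    (fun i => dp D i.+1) (fun i => dses D i.+1).

Fact rid_bij M : inj (rid M) /\ surj (rid M).
Proof. by split=> [x|x]; [rewrite ridE | exists x; rewrite ridE]. Qed.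

Fixpoint chain_ext (C : chain) n : yext n (cZ C n) (cZ C 0%N) :=
  match n with
  | 0 => exist _ (rid _) (rid_bij _)
  | n'.+1 => existT _ (Ext1 (cses C n')) (chain_ext C n')
  end.

Fixpoint cochain_ext n : forall D : cochain, yext n (dY D 0%N) (dY D n) :=
  match n with
  | 0 => fun D => exist _ (rid _) (rid_bij _)
  | n'.+1 => fun D => existT _ (Ext1 (dses D 0%N)) (cochain_ext n' (tail D))
  end.

Lemma chain_all_mid (C : chain) (c : module s A -> Prop) n :
  (forall i, c (cQ C i)) -> all_mid c (chain_ext C n).
Proof. by move=> h; elim: n => //= n IHn; split; first exact: (h n). Qed.

Lemma cochain_all_mid (D : cochain) (c : module s A -> Prop) n :
  (forall i, c (dJ D i)) -> all_mid c (cochain_ext n D).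
Proof.
elim: n D => //= n IHn D h; split; first exact: (h 0%N).
exact: (IHn (tail D) (fun i => h i.+1)).
Qed.

Lemma chain_lifts (C : chain) n L (c : rhom L (cZ C 0%N)) :
  lifts (chain_ext C n.+1) c <->
  exists t : rhom L (cQ C 0%N), forall x, cp C 0%N (t x) = c x.
Proof.
suff h : lifts_from (chain_ext C n) (cp C n) c <->
  exists t : rhom L (cQ C 0%N), forall x, cp C 0%N (t x) = c x by exact: h.
elim: n => [|n] //=.
by split=> -[t ht]; exists t => x; move: (ht x); rewrite ridE.
Qed.

Lemma cochain_lifts (D : cochain) n L (c : rhom L (dY D n.+1)) :
  lifts (cochain_ext n.+1 D) c <->
  exists t : rhom L (dJ D n), forall x, dp D n (t x) = c x.
Proof.
suff h D' (c' : rhom L (dY D' n.+1)) :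
    lifts_from (cochain_ext n (tail D')) (dp D' 0%N) c' <->
    exists t : rhom L (dJ D' n), forall x, dp D' n (t x) = c' x by exact: h.
elim: n D' c' {D c} => [|n IHn] D c /=.
  by split=> -[t ht]; exists t => x; move: (ht x); rewrite ridE.
exact: (IHn (tail D) c).
Qed.

(** When [C] is a projective resolution, the [k]-th hypothesis says that Ext^(k+1) from [cZ C 0] to
    [cQ C' k.+1] vanishes. *)
Lemma chain_ext_cond (C C' : chain) n :
  (forall k, (k < n)%N -> forall f : rhom (cZ C k.+1) (cQ C' k.+1),
     exists g : rhom (cQ C k) (cQ C' k.+1), forall x, g (ce C k x) = f x) ->
  ext_cond (chain_ext C n) (chain_ext C' n) (cQ C' n).
Proof.
elim: n => //= n IHn h; split; first exact: (h n (ltnSn n)).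
exact: (IHn (fun k kn => h k (ltnW kn))).
Qed.

Lemma lift_cond_cochain (D D' : cochain) n :
  (forall i, (i < n)%N -> forall f : rhom (dJ D i) (dY D' i.+1),
     exists g : rhom (dJ D i) (dJ D' i), forall x, dp D' i (g x) = f x) ->
  lift_cond (cochain_ext n D) (cochain_ext n D').
Proof.
elim: n D D' => //= n IHn D D' h; split; first exact: (h 0%N).
exact: (IHn (tail D) (tail D') (fun i lin => h i.+1 lin)).
Qed.

End Ladders.

(** * Syzygies, cosyzygies and dimension *)

Section Resolutions.
Variables (s : side) (K : fieldType) (A : falgType K).
Implicit Types M N L : module s A.

Definition corestr M N (f : rhom M N) : rhom M (sub_mod (im_mod f)) :=
  sval (cid (im_corestr f)).

Lemma corestr_surj M N (f : rhom M N) : surj (corestr f).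
Proof. by rewrite /corestr; case: cid => g [? ?]. Qed.

Lemma corestrE M N (f : rhom M N) x : incl (im_mod f) (corestr f x) = f x.
Proof. by rewrite /corestr; case: cid => g [? ?] /=. Qed.

Lemma corestr_eq0 M N (f : rhom M N) x : corestr f x = 0 <-> f x = 0.
Proof.
rewrite -(corestrE f); split=> [->|]; first by rewrite linear0.
exact: incl_inj.
Qed.

Section ProjRes.
Variables (M : module s A) (R : projres M).

(** The case split makes the zeroth syzygy [M] itself, so that [chain_ext] ends at [M] by
    computation. *)
Definition prZ i : module s A := if i is j.+1 then sub_mod (im_mod (pr_d R j)) else M.

Definition prp i : rhom (R i) (prZ i) :=
  match i with 0 => pr_aug R | j.+1 => corestr (pr_d R j) end.

Definition pre i : rhom (prZ i.+1) (R i) := incl (im_mod (pr_d R i)).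

Lemma prp_eq0 i x : prp i x = 0 <-> x \in limg (pr_d R i).
Proof.
case: i x => [|i] x; rewrite ?pr_exact0 ?pr_exact memv_ker /=.
  by split=> [->|/eqP].
by rewrite corestr_eq0; split=> [->|/eqP].
Qed.

Lemma pr_ses i : ses (pre i) (prp i).
Proof.
split=> [||x]; first exact: incl_inj.
  by case: i => [|i]; [exact/limg_surj/pr_surj | exact: corestr_surj].
rewrite prp_eq0; split=> [/(incl_ex (U := im_mod _))//|[y <-]].
exact: incl_mem.
Qed.

Definition pr_chain : chain s A := Chain pr_ses.

Lemma pr_chain_superfluous : minimal_projres R ->
  forall i, superfluousr (cp pr_chain i).
Proof.
move=> [m0 m] [|i]; first exact: superfluousP m0.
move=> W hW; apply: (superfluousP (m i)) => x; have [w wW e] := hW x.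
by exists w => //; rewrite -!(corestrE (pr_d R i)); congr (incl _ _).
Qed.

End ProjRes.

Section InjCores.
Variables (M : module s A) (R : injcores M).

Definition icY i : module s A := if i is j.+1 then sub_mod (im_mod (ic_d R j)) else M.

Definition ice i : rhom (icY i) (R i) :=
  match i with 0 => ic_coaug R | j.+1 => incl (im_mod (ic_d R j)) end.

Definition icp i : rhom (R i) (icY i.+1) := corestr (ic_d R i).

Lemma ic_ses i : ses (ice i) (icp i).
Proof.
split=> [||x]; last 1 first.
- rewrite corestr_eq0; split=> [e|].
    have: x \in lker (ic_d R i) by rewrite memv_ker e.
    case: i x {e} => [|i] x.
      by rewrite -ic_exact0 => /memv_imgP[y _ ->]; exists y.
    by rewrite -ic_exact => /(incl_ex (U := im_mod _)).
  case: i x => [|i] x [y <-]; apply/eqP; rewrite -memv_ker.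
    by rewrite -ic_exact0 memv_img ?memvf.
  by rewrite -ic_exact; exact: (incl_mem (U := im_mod _)).
- by case: i => [|i]; [exact/lker_inj/ic_mono | exact: incl_inj].
- exact: corestr_surj.
Qed.

Definition ic_cochain : cochain s A := Cochain ic_ses.

Lemma ic_cochain_essential : minimal_injcores R ->
  forall i, essentialr (de ic_cochain i).
Proof.
move=> [m0 m] [|i]; first exact: essentialP m0.
move=> W hW; apply: (essentialP (m i)) => x fxW.
by have := hW (corestr (ic_d R i) x); rewrite /= corestrE => ->.
Qed.

End InjCores.

Lemma lifts_of_extends_inj n M N M' N' (E : yext n M N) (E' : yext n M' N')
    (a : rhom M M') (c : rhom N N') :
  ladder E E' a c -> all_mid (@injective_mod s K A) E' -> extends E a -> lifts E' c.
Proof.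
move=> h iE' ea; apply: lifts_of_extends h ea _.
by case: n E E' iE' => [//|n] E E' /= [i1 i2]; exact: injective_ext_cond.
Qed.

Lemma extends_zero n M N (E : yext n M N) L (a : rhom M L) :
  (forall x, a x = 0) -> extends E a.
Proof.
by case: n E => [//|n] E a0; exists (rzero _ _) => x; rewrite rzeroE a0.
Qed.

(* Vanishing of Ext^1 (M, Y_(n+1)) = Ext^(n+1) (M, Y_0). *)
Definition lift_dim M n : Prop :=
  forall D : cochain s A, (forall i, injective_mod (dJ D i)) ->
  forall f : rhom M (dY D n.+1),
    exists t : rhom M (dJ D n), forall x, dp D n (t x) = f x.

Lemma lift_dim_retract M N n (i : rhom N M) (r : rhom M N) :
  (forall x, r (i x) = x) -> lift_dim M n -> lift_dim N n.
Proof.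
move=> ri ld D iD f; have [t ht] := ld D iD (rhom_comp f r).
by exists (rhom_comp t i) => x; rewrite rcompE ht rcompE ri.
Qed.

Lemma prZ_zero M (R : projres M) i : zero_mod (R i.+1) -> zero_mod (prZ R i.+1).
Proof.
move=> Q0; apply/zero_modP => x; have [_ sp _] := pr_ses R i.+1.
by have [y <-] := sp x; exact: zero_rhom.
Qed.

(** In a resolution of length [n] the syzygy of index [n.+1] is zero. A ladder lifting [f] therefore
    has zero left end map, its class vanishes, and [f] lifts. *)
Lemma pdim_lift_dim M n : pdim_le M n -> lift_dim M n.
Proof.
move=> [R R0] D iD f; apply/cochain_lifts.
have pR : all_mid (@projective s K A) (chain_ext (pr_chain R) n.+1).
  by apply: chain_all_mid => i; exact: pr_proj.
have iDE := cochain_all_mid n.+1 iD.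
have [a ha] := ladder_backward f (projective_lift_cond (cochain_ext n.+1 D) pR).
apply: lifts_of_extends_inj ha iDE _; apply: extends_zero => x.
apply: zero_rhom; exact/prZ_zero/R0.
Qed.

Lemma prp_inj M (R : projres M) i : zero_mod (prZ R i.+1) -> inj (prp R i).
Proof.
move=> /zero_modP Z0; have [_ _ ex] := pr_ses R i.
by move=> x /ex[y <-]; rewrite (Z0 y) linear0.
Qed.

Lemma zero_target M N (f : rhom M N) : inj f -> zero_mod N -> zero_mod M.
Proof.
by move=> fi /zero_modP N0; apply/zero_modP => x; apply: fi; exact: N0.
Qed.

Lemma superfluousr_zero M N (f : rhom M N) : superfluousr f -> zero_mod N -> zero_mod M.
Proof.
move=> sf /zero_modP N0; apply/zero_modP => x; apply/eqP; rewrite -memv0.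
apply: (sf (zero_sub M)) => y; exists 0; first exact: mem0v.
by rewrite (N0 (f y)) linear0.
Qed.

(** The kernel of [t] is a complement of the image of [e], hence maps onto [N]. Superfluity makes it
    all of [M], so [t = 0] while [t e] is the identity. *)
Lemma superfluousr_section M N L (e : rhom L M) (f : rhom M N) (t : rhom M L) :
  ses e f -> superfluousr f -> (forall x, t (e x) = x) -> zero_mod L.
Proof.
move=> [ei fs ef] sf te; apply/zero_modP => x; rewrite -[x]te.
apply/rker_mem; apply: sf => y; exists (y - e (t y)).
  by apply/rker_mem; rewrite linearB /= te subrr.
rewrite linearB /= (_ : f (e (t y)) = 0) ?subr0 //.
by apply/ef; exists (t y).
Qed.

(** The identity of the syzygy of index [n.+1] is carried into the test coresolution [R'];
    [lift_dim] shows that its class vanishes. The inclusion of this syzygy then splits, so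
    minimality makes the syzygy zero. *)
Lemma minimal_projres_zero M (R : projres M) n (R' : injcores (prZ R n.+1)) :
  minimal_projres R -> lift_dim M n -> forall i, (n < i)%N -> zero_mod (R i).
Proof.
move=> /pr_chain_superfluous sR ld; pose C := pr_chain R; pose D := ic_cochain R'.
have iD i : injective_mod (dJ D i) by exact: ic_inj.
have iDE := cochain_all_mid n.+1 iD.
have pC : all_mid (@projective s K A) (chain_ext C n.+1).
  by apply: chain_all_mid => i; exact: pr_proj.
have [c hc] := ladder_forward (chain_ext C n.+1) (rid (dY D 0%N)) iDE.
have [t ht] : extends (chain_ext C n.+1) (rid (dY D 0%N)).
  by apply: extends_of_lifts hc pC _; apply/cochain_lifts; exact: ld.
have Z0 : zero_mod (prZ R n.+1).
  apply: (superfluousr_section (pr_ses R n) (sR n) (t := t)) => x.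
  exact: etrans (ht x) (ridE x).
have ZQ i : zero_mod (prZ R i) -> zero_mod (R i) by exact: superfluousr_zero (sR i).
have QZ i : zero_mod (R i) -> zero_mod (prZ R i.+1).
  by have [ei _ _] := pr_ses R i; exact: zero_target ei.
move=> i /subnKC <-; elim: (i - n.+1)%N => [|k IHk].
  by rewrite addn0; exact: ZQ.
by rewrite addnS; exact/ZQ/QZ.
Qed.

End Resolutions.

(** * Injective envelopes and projective covers *)

Section Envelopes.
Variables (s : side) (K : fieldType) (A : falgType K).
Implicit Types M N L : module s A.

(** A Fitting power is injective, hence bijective, on its own image; inverting it there gives the
    retraction. *)
Lemma fitting_retract M (f : rhom M M) : exists n,
  exists r : rhom M (sub_mod (im_mod (riter f n.+1))),
    forall x, r (incl _ x) = x.
Proof.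
have [n [_ cap_]] := fitting f; exists n; set g := riter f n.+1 in cap_ *.
have [g' [g's g'E]] := im_corestr g.
pose h := rhom_comp g' (incl (im_mod g)).
have hi : inj h.
  move=> x; rewrite rcompE => e; have /rim_mem[y ye] := incl_mem x.
  apply: (incl_inj (U := im_mod g)); rewrite -ye cap_ //.
  by rewrite ye -g'E e linear0.
have [k [kh _]] := inv_rhom hi (inj_surj hi (leqnn _)).
by exists (rhom_comp k g') => x; rewrite rcompE -[RHS]kh [in RHS]rcompE.
Qed.

Lemma riter_fixed M (f : rhom M M) n x : f x = x -> riter f n x = x.
Proof. by move=> fx; rewrite riterE; elim: n => //= n ->. Qed.

Lemma noninj_im_dim M N (f : rhom M N) x : f x = 0 -> x <> 0 ->
  (\dim {: sub_mod (im_mod f)} < \dim {:M})%N.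
Proof.
move=> fx x0; have [g [gs gE]] := im_corestr f; rewrite ltnNge; apply/negP => le.
by apply: x0; apply: (surj_inj gs le); apply: (incl_inj (U := im_mod f)); rewrite gE fx.
Qed.

(** If a nonzero [W] meets the image of [e] trivially, [N] embeds in [E / W], and extending [e]
    along this embedding gives an endomorphism of [E] that fixes the image of [e] and kills [W]. The
    image of a Fitting power is a smaller injective summand still containing [N]. *)
Lemma injective_envelope N (E : module s A) (e : rhom N E) : injective_mod E -> inj e ->
  exists E' (e' : rhom N E'), [/\ injective_mod E', inj e' & essentialr e'].
Proof.
have [d le] := ubnP (\dim {:E}); elim: d => // d IHd in E e le *.
move=> iE ie; have [ess|ness] := pselect (essentialr e); first by exists E, e.
have [W [hW [y yW y0]]] : exists W : submod E,
    (forall x, e x \in (W : {vspace E}) -> e x = 0) /\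
    exists2 y, y \in (W : {vspace E}) & y <> 0.
  apply: contrapT => h; apply: ness => W hW y yW; apply: contrapT => y0.
  by apply: h; exists W; split=> //; exists y.
have [q [sq qE]] := quo_rhom W.
have [x|p hp] := injective_extend (g := rhom_comp q e) e iE.
  by rewrite rcompE => /qE/hW/ie.
pose f := rhom_comp p q; have fe x : f (e x) = e x by rewrite rcompE -[RHS]hp rcompE.
have [n [r hr]] := fitting_retract f; set g := riter f n.+1 in r hr.
have gy : g y = 0.
  by rewrite riterE iterSr rcompE (proj2 (qE y) yW) linear0 -riterE linear0.
have iE' := retract_injective hr iE.
have [x|e' he'] := factor_inj (f := e) (incl_inj (U := im_mod g)).
  by apply: incl_ex; apply/rim_mem; exists (e x); exact: riter_fixed.
apply: (IHd _ e') iE' _.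
  by have := noninj_im_dim gy y0; move/leq_trans; apply.
by move=> x e'x; apply: ie; rewrite -he' e'x linear0.
Qed.

(** Dual argument: if a proper [W] still maps onto [M], lifting [p] to [W] gives an endomorphism
    over [M] with image in [W], and the image of a Fitting power is a smaller projective summand. *)
Lemma projective_cover M (Q : module s A) (p : rhom Q M) : projective Q -> surj p ->
  exists Q' (p' : rhom Q' M), [/\ projective Q', surj p' & superfluousr p'].
Proof.
have [d le] := ubnP (\dim {:Q}); elim: d => // d IHd in Q p le *.
move=> pQ sp; have [sup|nsup] := pselect (superfluousr p); first by exists Q, p.
have [W [hW [y yW]]] : exists W : submod Q,
    (forall x, exists2 w, w \in (W : {vspace Q}) & p w = p x) /\
    exists y, y \notin (W : {vspace Q}).
  apply: contrapT => h; apply: nsup => W hW y; apply: contrapT => /negP yW.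
  by apply: h; exists W; split=> //; exists y.
have spW : surj (rhom_comp p (incl W)).
  move=> z; have [x <-] := sp z; have [w wW <-] := hW x.
  by have [v <-] := incl_ex wW; exists v; rewrite rcompE.
have [h hh] := projective_lift p pQ spW.
pose f := rhom_comp (incl W) h.
have pf x : p (f x) = p x by rewrite rcompE -[RHS]hh rcompE.
have [n [r hr]] := fitting_retract f; set g := riter f n.+1 in r hr.
have pg x : p (g x) = p x by rewrite riterE; elim: n.+1 => //= m <-; rewrite pf.
(* An injective [g] would be surjective by dimension, but its image lies in [W], which misses
   [y]. *)
have [z gz z0] : exists2 z, g z = 0 & z <> 0.
  apply: contrapT => h0; move/negP: yW; apply.
  have gi : inj g by move=> z gz; apply: contrapT => z0; apply: h0; exists z.
  have [x <-] := inj_surj gi (leqnn _) y.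
  by rewrite riterE iterS rcompE; exact: incl_mem.
apply: (IHd _ (rhom_comp p (incl (im_mod g)))).
- by have := noninj_im_dim gz z0; move/leq_trans; apply.
- exact: retract_projective hr pQ.
- move=> x; have [w <-] := sp x; have [v ve] : exists v, incl (im_mod g) v = g w.
    by apply: incl_ex; apply/rim_mem; exists w.
  by exists v; rewrite rcompE ve pg.
Qed.

End Envelopes.

(** * Coinduced modules and existence of minimal resolutions *)

Section Coinduced.
Variables (K : fieldType) (A : falgType K).
Implicit Types M N : rmod A.

(** The action making Hom_K(A, N) a coinduced right module; it provides enough injectives. *)
Definition coind_act N (f : 'Hom(A, N)) (a : A) : 'Hom(A, N) := (f \o amull a)%VF.

Lemma coind_actE N (f : 'Hom(A, N)) a b : coind_act f a b = f (a * b).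
Proof. by rewrite comp_lfunE lfunE. Qed.

Fact coind_linl N a : linear ((@coind_act N)^~ a).
Proof.
by move=> k f g; apply/lfunP => b; rewrite coind_actE !add_lfunE !scale_lfunE !coind_actE.
Qed.
Fact coind_linr N f : linear (@coind_act N f).
Proof.
move=> k a b; apply/lfunP => c.
by rewrite add_lfunE scale_lfunE !coind_actE mulrDl -scalerAl linearP.
Qed.
Fact coind_act1 N f : @coind_act N f 1 = f.
Proof. by apply/lfunP => b; rewrite coind_actE mul1r. Qed.
Fact coind_actM N f a b : @coind_act N f (a * b) = coind_act (coind_act f a) b.
Proof. by apply/lfunP => c; rewrite !coind_actE mulrA. Qed.

Definition coind N : rmod A :=
  @Module Rgt K A _ _ (@coind_linl N) (@coind_linr N) (@coind_act1 N) (@coind_actM N).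

(** Maps into a coinduced module correspond, through evaluation at 1, to [K]-linear maps; these
    extend along [g] by means of its linear left inverse. *)
Lemma coind_injective N : injective_mod (coind N).
Proof.
move=> X Y g f /eqP g0.
pose h (y : Y) : A -> N := fun b => (f ((g^-1)%VF (y ** b)) : 'Hom(A, N)) 1.
have hl y : linear (h y).
  by move=> k a b; rewrite /h mactPr !linearP add_lfunE scale_lfunE.
pose hy y : {linear A -> N} :=
  HB.pack (h y) (GRing.isLinear.Build K A N *:%R (h y) (hl y)).
pose H (y : Y) : coind N := linfun (hy y).
have HE y b : (H y : 'Hom(A, N)) b = h y b by rewrite lfunE.
have [|y a|k hk] := @rhom_ex _ _ _ Y (coind N) H.
- move=> k y z; apply/lfunP => b.
  rewrite HE; rewrite add_lfunE scale_lfunE !HE /h mactPl !linearP.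
  by rewrite add_lfunE scale_lfunE.
- by apply/lfunP => b; rewrite HE [RHS]coind_actE HE /h -mactM.
exists k => x; rewrite hk; apply/lfunP => b.
by rewrite HE /h -rhomP lker0_lfunK // rhomP [LHS]coind_actE mulr1.
Qed.

Lemma coind_embed N : exists e : rhom N (coind N), inj e.
Proof.
pose hn (n : N) : {linear A -> N} :=
  HB.pack (mact n) (GRing.isLinear.Build K A N *:%R (mact n) (mact_linearr n)).
pose H (n : N) : coind N := linfun (hn n).
have HE n b : (H n : 'Hom(A, N)) b = n ** b by rewrite lfunE.
have [|y a|k hk] := @rhom_ex _ _ _ N (coind N) H.
- by move=> k y z; apply/lfunP => b; rewrite HE add_lfunE scale_lfunE !HE mactPl.
- by apply/lfunP => b; rewrite HE [RHS]coind_actE HE -mactM.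
exists k => x; rewrite hk => e; rewrite -[x]mact1 -HE e; exact: zero_lfunE.
Qed.

Record envelope N := Envelope {
  env : rmod A;
  env_map : rhom N env;
  env_injective : injective_mod env;
  env_inj : inj env_map;
  env_essential : essentialr env_map }.

(** The form [exists _, True] turns the record into a proposition from which [cid] chooses. *)
Lemma envelope_ex N : exists _ : envelope N, True.
Proof.
have [e ie] := coind_embed N.
have [E [e' [iE ie' ee']]] := injective_envelope (@coind_injective N) ie.
by exists (Envelope iE ie' ee').
Qed.

Definition envelope_of N : envelope N := sval (cid (envelope_ex N)).

Definition cosyz N : rmod A := quo_mod (im_mod (env_map (envelope_of N))).

Definition cosyz_map N : rhom (env (envelope_of N)) (cosyz N) :=
  sval (cid (quo_rhom (im_mod (env_map (envelope_of N))))).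

Lemma cosyz_map_surj N : surj (cosyz_map N).
Proof. by rewrite /cosyz_map; case: cid => q [? ?]. Qed.

Lemma cosyz_map_eq0 N x :
  cosyz_map N x = 0 <-> x \in limg (env_map (envelope_of N)).
Proof. by rewrite /cosyz_map; case: cid => q [? ?]. Qed.

Lemma minimal_injcores_ex N : exists R : injcores N, minimal_injcores R.
Proof.
pose Y i := iter i cosyz N; pose J i := env (envelope_of (Y i)).
pose e i : rhom (Y i) (J i) := env_map (envelope_of (Y i)).
pose d i : rhom (J i) (J i.+1) := rhom_comp (e i.+1) (cosyz_map (Y i)).
have dim i : limg (d i) = limg (e i.+1).
  apply/vspaceP=> x; apply/memv_imgP/memv_imgP => -[y _ ->]; rewrite ?rcompE.
    by exists (cosyz_map (Y i) y); rewrite ?memvf.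
  have [z <-] := cosyz_map_surj y; by exists z; rewrite ?memvf ?rcompE.
have dker i : limg (e i) = lker (d i).
  apply/vspaceP=> x; apply/idP/idP => [/cosyz_map_eq0 h|].
    by rewrite memv_ker rcompE h linear0.
  by rewrite memv_ker rcompE => /eqP/(@env_inj _ (envelope_of (Y i.+1)))/cosyz_map_eq0.
have iJ i : injective_mod (J i) by exact: env_injective.
have mono : lker (e 0%N) = 0%VS by apply/lker_inj; exact: env_inj.
have ex i : limg (d i) = lker (d i.+1) by rewrite dim dker.
exists (InjCores iJ mono (dker 0%N) ex); split=> [|i] /=.
  exact/essentialr_limg/env_essential.
by rewrite dim; exact/essentialr_limg/env_essential.
Qed.

Record pcover M := PCover {
  pcov : rmod A;
  pcov_map : rhom pcov M;
  pcov_projective : projective pcov;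
  pcov_surj : surj pcov_map;
  pcov_superfluous : superfluousr pcov_map }.

Lemma pcover_ex M : exists _ : pcover M, True.
Proof.
have sc : surj (cover M) by exact/limg_surj/cover_surj.
have [Q [p [pQ sp ssp]]] := projective_cover (@free_projective K A _) sc.
by exists (PCover pQ sp ssp).
Qed.

Definition pcover_of M : pcover M := sval (cid (pcover_ex M)).

Definition msyz M : rmod A := sub_mod (ker_mod (pcov_map (pcover_of M))).

Lemma minimal_projres_ex M : exists R : projres M, minimal_projres R.
Proof.
pose Z i := iter i msyz M; pose Q i := pcov (pcover_of (Z i)).
pose p i : rhom (Q i) (Z i) := pcov_map (pcover_of (Z i)).
pose d i : rhom (Q i.+1) (Q i) := rhom_comp (incl (ker_mod (p i))) (p i.+1).
have dker i : lker (d i) = lker (p i.+1).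
  apply/vspaceP=> x; rewrite !memv_ker rcompE; apply/eqP/eqP => [|->].
    exact: incl_inj.
  exact: linear0.
have dim i : limg (d i) = lker (p i).
  apply/vspaceP=> x; apply/memv_imgP/idP => [[y _ ->]|xk].
    by rewrite rcompE; exact: (incl_mem (U := ker_mod (p i))).
  have [z <-] := incl_ex (U := ker_mod (p i)) xk.
  have [y <-] := @pcov_surj _ (pcover_of (Z i.+1)) z.
  by exists y; rewrite ?memvf ?rcompE.
have pQ i : projective (Q i) by exact: pcov_projective.
have aug : limg (p 0%N) = fullv by apply/limg_surj; exact: pcov_surj.
have ex i : limg (d i.+1) = lker (d i) by rewrite dim dker.
exists (ProjRes pQ aug (dim 0%N) ex); split=> [|i] /=.
  exact/superfluousr_lker/pcov_superfluous.
by rewrite dker; exact/superfluousr_lker/pcov_superfluous.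
Qed.

End Coinduced.

(** * Ext classes and tops *)

Section Functionals.
Variables (K : fieldType) (V : vectType K).

Lemma functional_ex (v : V) : v <> 0 -> exists f : 'Hom(V, K^o), f v <> 0.
Proof.
move=> v0; apply: contrapT => h; apply: v0.
rewrite (coord_vbasis (memvf v)) big1 // => i _.
suff -> : coord (vbasis {:V}) i v = 0 by rewrite scale0r.
apply: contrapT => ci; apply: h.
by exists (linfun (coord (vbasis {:V}) i : V -> K^o)); rewrite lfunE.
Qed.

Lemma bidual_eval (F : 'Hom('Hom(V, K^o), K^o)) : exists v, forall f, F f = f v.
Proof.
pose c i : 'Hom(V, K^o) := linfun (coord (vbasis {:V}) i : V -> K^o).
exists (\sum_(i < \dim {:V}) (F (c i) : K) *: (vbasis {:V})`_i) => f.
have e : f = \sum_(i < \dim {:V}) (f (vbasis {:V})`_i : K) *: c i.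
  apply/lfunP => v; rewrite {1}(coord_vbasis (memvf v)) linear_sum sum_lfunE.
  apply: eq_bigr => i _; rewrite linearZ scale_lfunE lfunE /=; exact: mulrC.
rewrite {1}e !linear_sum /=; apply: eq_bigr => i _; rewrite !linearZ /=; exact: mulrC.
Qed.

End Functionals.

Section ExtClasses.
Variables (K : fieldType) (A : falgType K).
Implicit Types M N Q : rmod A.

Lemma generated_map M (m : M) : exists f : rhom (reg A) M, forall a, f a = m ** a.
Proof. by apply: rhom_ex => [|a b]; [exact: mact_linearr | rewrite -mactM]. Qed.

Lemma lmul_ex (a : A) : exists f : rhom (reg A) (reg A), forall b, f b = a * b.
Proof. exact: (generated_map (M := reg A) a). Qed.

Definition lmul (a : A) : rhom (reg A) (reg A) := sval (cid (lmul_ex a)).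

Lemma lmulE a b : lmul a b = a * b.
Proof. by rewrite /lmul; case: cid. Qed.

(** [Q] is a retract of a free module, so extensions of the coordinates of [f] assemble into an
    extension of [f]. *)
Lemma extends_reg n M N (E : yext n M N) Q (f : rhom M Q) : projective Q ->
  (forall k : rhom Q (reg A), extends E (rhom_comp k f)) -> extends E f.
Proof.
move=> pQ; set d := \dim {:Q}; pose C : rhom (free_mod A d) Q := cover Q.
have sC : surj C by exact/limg_surj/cover_surj.
have [sg hs] := projective_lift (rid Q) pQ sC.
have co (i : 'I_d) : exists k : rhom (free_mod A d) (reg A), forall x, k x = x i.
  by apply: rhom_ex => [k x y|x a]; rewrite !ffunE.
have {}hs x : C (sg x) = x by rewrite hs ridE.
move=> h; have {}h i : exists2 k : rhom Q (reg A), (forall x, k x = sg x i) &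
    extends E (rhom_comp k f).
  have [k hk] := co i; exists (rhom_comp k sg); last exact: h.
  by move=> x; rewrite rcompE hk.
case: n E h => [|n] E h.
  move=> x; rewrite -[LHS]hs; suff -> : sg (f x) = 0 by rewrite linear0.
  apply/ffunP => i; have [k hk e] := h i; rewrite -hk ffunE -(rcompE k); exact: e.
have /choice[t ht] : forall i : 'I_d, exists t : rhom (mid E) (reg A),
    forall x, t (yin E x) = sg (f x) i.
  by move=> i; have [k hk [t ht]] := h i; exists t => x; rewrite ht rcompE hk.
have [|x a|T hT] := @rhom_ex _ _ _ (mid E) (free_mod A d) (fun x => [ffun i => t i x]).
- by move=> k x y; apply/ffunP => i; rewrite !ffunE linearP.
- by apply/ffunP => i; rewrite !ffunE rhomP.
exists (rhom_comp C T) => x; rewrite rcompE -[RHS]hs; congr (C _).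
by rewrite hT; apply/ffunP => i; rewrite ffunE ht.
Qed.

Lemma precomp_val M N (f : rhom M N) (g : homA N) x :
  vsval (precomp f g) x = vsval g (f x).
Proof. by rewrite lfunE /= precompE. Qed.

Section Classes.
Variables (M : rmod A) (R : projres M).

Lemma homA_rhom N (f : homA N) : exists g : rhom N (reg A), forall x, g x = vsval f x.
Proof.
have hf x a : vsval f (x ** a) = vsval f x * a by exact: (proj1 (homA_spP _) (subvsP f)).
by exists (@RHom Rgt K A N (reg A) (vsval f) hf).
Qed.

Lemma rhom_homA N (g : rhom N (reg A)) : exists f : homA N, forall x, vsval f x = g x.
Proof.
have gN : rhom_fun g \in homA_sp N by apply/homA_spP; exact: (rhomP g).
by exists (vsproj (homA_sp N) (rhom_fun g)) => x; rewrite vsprojK.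
Qed.

(** Cochains factoring through the [i]-th syzygy are handled as maps on the syzygy; this translates
    the quotient defining Ext into the language of [extends]. *)
Lemma coboundaryP i (phi : homA (R i)) (f : rhom (prZ R i) (reg A)) :
  (forall x, vsval phi x = f (prp R i x)) ->
  phi \in (coboundaries R i : {vspace _}) <-> extends (chain_ext (pr_chain R) i) f.
Proof.
have [_ sp _] := pr_ses R i; case: i sp phi f => [|j] sp phi f hphi.
  rewrite memv0; split=> [/eqP p0 y|f0].
    by have [x <-] := sp y; rewrite -hphi p0 zero_lfunE.
  by apply/eqP; apply: subvs_inj; apply/lfunP => x; rewrite hphi f0 zero_lfunE.
split=> [/memv_imgP[psi _ e]|[t ht]].
  have [t ht] := homA_rhom psi; exists t => y; have [x <-] := sp y.
  rewrite -hphi e precomp_val -ht; congr (t _); exact: corestrE.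
have [psi hpsi] := rhom_homA t; apply/memv_imgP; exists psi; first exact: memvf.
apply: subvs_inj; apply/lfunP => x; rewrite precomp_val hpsi hphi -ht.
by congr (t _); exact: corestrE.
Qed.

Lemma cocycleP i (phi : homA (R i)) :
  phi \in (cocycles R i : {vspace _}) <-> forall x, vsval phi (pr_d R i x) = 0.
Proof.
rewrite memv_ker; split=> [/eqP e x|h].
  by rewrite -precomp_val e zero_lfunE.
by apply/eqP; apply: subvs_inj; apply/lfunP => x; rewrite precomp_val h zero_lfunE.
Qed.

(** [f] is the map induced on the syzygy by a cocycle representing [x], and [a] acts on the class by
    left multiplication of values. *)
Lemma Ext_act_eq0 i (x : ExtA_of R i) : exists f : rhom (prZ R i) (reg A),
  forall a, x ** a = 0 <-> extends (chain_ext (pr_chain R) i) (rhom_comp (lmul a) f).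
Proof.
pose Z := cocycles R i; pose z : sub_mod Z := vsval x; pose phi := incl Z z.
have /cocycleP phiZ : phi \in (Z : {vspace _}) by exact: incl_mem.
have [g hg] := homA_rhom phi; have [_ sp _] := pr_ses R i.
have [|f hf] := factor_surj (f := g) sp.
  by move=> y /prp_eq0/memv_imgP[w _ ->]; rewrite hg phiZ.
exists f => a; rewrite -(coboundaryP (phi := phi ** a)); last first.
  by move=> y; rewrite homA_actE rcompE lmulE hf hg.
have -> : x ** a =
    quo_proj (SubMod (@meet_subproof _ _ _ _ Z (coboundaries R i))) (z ** a) by [].
rewrite -rhomP; split=> [/eqP|h].
  by rewrite quo_proj_eq0 /= -memv_preim.
by apply/eqP; rewrite quo_proj_eq0 /= -memv_preim.
Qed.

Lemma Ext_zero_extends i (f : rhom (prZ R i) (reg A)) : zero_mod (ExtA_of R i) ->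
  extends (chain_ext (pr_chain R) i) f.
Proof.
move=> E0; pose Z := cocycles R i.
have [phi hphi] := rhom_homA (rhom_comp f (prp R i)).
have phiZ : phi \in (Z : {vspace _}).
  apply/cocycleP => x; rewrite hphi rcompE.
  have -> : prp R i (pr_d R i x) = 0 by apply/prp_eq0/memv_img/memvf.
  exact: linear0.
have [z hz] := incl_ex phiZ.
apply/(coboundaryP (phi := phi)); first by move=> x; rewrite hphi rcompE.
have /eqP := (proj1 (zero_modP _) E0)
  (quo_proj (SubMod (@meet_subproof _ _ _ _ Z (coboundaries R i))) z).
by rewrite quo_proj_eq0 /= -memv_preim hz.
Qed.

Lemma Ext_zero_extends_projective i Q (f : rhom (prZ R i) Q) : projective Q ->
  zero_mod (ExtA_of R i) -> extends (chain_ext (pr_chain R) i) f.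
Proof. by move=> pQ E0; apply: extends_reg => // k; exact: Ext_zero_extends. Qed.

End Classes.

(** By reflexivity of finite-dimensional spaces, the functional [l t] on the dual of [E] is
    evaluation at some [x]; functionals on [E] separate points, whence the annihilator criterion. *)
Lemma dual_quotient_elt (E : lmod A) (T : rmod A) (t : rhom (dual E) T)
    (l : 'Hom(T, K^o)) : surj t ->
  exists x : E, forall a, x ** a = 0 <-> forall y, l (y ** a) = 0.
Proof.
move=> st; have [x hx] := bidual_eval ((l \o rhom_fun t)%VF : 'Hom('Hom(E, K^o), K^o)).
have key (f : dual E) a : l (t f ** a) = (f : 'Hom(E, K^o)) (x ** a).
  by rewrite -rhomP -[LHS](comp_lfunE l (rhom_fun t)) hx [LHS]dual_actE.
exists x => a; split=> [e y|h].
  by have [f <-] := st y; rewrite key e linear0.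
by apply: contrapT => /functional_ex[f]; apply; rewrite -[LHS](key f).
Qed.

Lemma maximal_ex M (W : submod M) : (W : {vspace M}) <> fullv ->
  exists2 U : submod M, maximal_submod U & (W <= U)%VS.
Proof.
have [d le] := ubnP (\dim {:M} - \dim W); elim: d => // d IHd in W le *.
move=> WT; have [mW|nW] := pselect (maximal_submod W); first by exists W.
have [W' [WW' ne neT]] : exists W' : submod M,
    [/\ (W <= W')%VS, (W' : {vspace M}) <> W & (W' : {vspace M}) <> fullv].
  apply: contrapT => h; apply: nW; split=> // W' WW'; apply: contrapT => /not_orP[n1 n2].
  by apply: h; exists W'.
have lt : (\dim W < \dim W')%N.
  rewrite ltnNge; apply/negP => le'; apply: ne; apply/esym/eqP.
  by rewrite eqEdim WW'.
have [|U mU WU] := IHd W' _ neT; last by exists U => //; exact: subv_trans WW' WU.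
rewrite ltnS in le; apply: leq_trans le; apply: ltn_sub2l => //.
exact: leq_trans lt (dimvS (subvf W')).
Qed.

Fact add_subproof M (U W : submod M) x a : x \in (U + W)%VS -> x ** a \in (U + W)%VS.
Proof.
move=> /memv_addP[u uU [w wW ->]]; rewrite -mactfE linearD /= !mactfE.
by apply: memv_add; exact: submodP.
Qed.

(** Two distinct maximal submodules [U] and [W] would span [P], so [U] would map onto [P / W].
    Lifting the projection gives an endomorphism with image in [U] that is the identity modulo [W];
    injectivity forces [U = P], nilpotency forces [W = P]. *)
Lemma maximal_le_rad (P : rmod A) (U : submod P) :
  indecomposable P -> projective P -> maximal_submod U -> (U <= rad P)%VS.
Proof.
move=> indP pP mU; apply/subvP => x xU; apply/rad_spP => W mW.
apply: contrapT => /negP xW; have [nW hW] := mW; have [nU _] := mU.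
have [|sumT] := hW (SubMod (@add_subproof _ U W)) (addvSr _ _).
  by move=> /= e; move: xW; rewrite -e (subvP (addvSl _ _)).
have [q [sq qE]] := quo_rhom W.
have sqU : surj (rhom_comp q (incl U)).
  move=> z; have [y <-] := sq z.
  have : y \in (U + W)%VS by rewrite [(U + W)%VS]sumT memvf.
  move=> /memv_addP[u uU [w wW ->]]; have [v hv] := incl_ex uU.
  exists v; rewrite rcompE hv linearD /= (_ : q w = 0) ?addr0 //; exact/qE.
have [h hh] := projective_lift q pP sqU.
pose f := rhom_comp (incl U) h.
have qf y : q (f y) = q y by rewrite rcompE -[RHS]hh rcompE.
have [fi|[n fn]] := indecomposable_endo f indP.
  apply: nU; apply/vspaceP => y; rewrite memvf.
  by have [z <-] := inj_surj fi (leqnn _) y; rewrite rcompE incl_mem.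
apply: nW; apply/vspaceP => y; rewrite memvf; apply/qE.
have <- : q (riter f n y) = q y by rewrite riterE; elim: n {fn} => //= n <-; rewrite qf.
by rewrite fn linear0.
Qed.

Lemma surj_of_notin_rad (P : rmod A) N (f : rhom N P) x :
  indecomposable P -> projective P -> f x \notin rad_sp P -> surj f.
Proof.
move=> indP pP fx; apply/limg_surj; apply: contrapT => nT.
have [U mU fU] := maximal_ex (W := im_mod f) nT.
move/negP: fx; apply; apply: (subvP (maximal_le_rad indP pP mU)).
by apply: (subvP fU); rewrite memv_img ?memvf.
Qed.

Lemma notin_rad_ex (P : rmod A) : indecomposable P -> exists x, x \notin rad_sp P.
Proof.
move=> [nP _]; have [|U mU _] := maximal_ex (W := zero_sub P).
  by move=> /= e; apply: nP; rewrite /zero_mod -e dimv0.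
have [nU _] := mU; apply: contrapT => h; apply: nU; apply/vspaceP => x; rewrite memvf.
suff /rad_spP xU : x \in rad_sp P by exact: (xU U mU).
by apply: contrapT => /negP hx; apply: h; exists x.
Qed.

Lemma indecomposable_retract_reg (P : rmod A) x : indecomposable P -> projective P ->
  x \notin rad_sp P -> exists (a : rhom P (reg A)) (b : rhom (reg A) P),
  (forall c, b c = x ** c) /\ forall y, b (a y) = y.
Proof.
move=> indP pP xP; have [b hb] := generated_map x.
have b1 : b (1 : A) \notin rad_sp P by rewrite hb mact1.
have sb : surj b := surj_of_notin_rad indP pP b1.
have [a ha] := projective_lift (rid P) pP sb.
by exists a, b; split=> // y; rewrite ha ridE.
Qed.

(** A functional on [top P] that is nonzero at the class of a generator [x0] pulls back to an
    element [x] of Ext^g(M, A); [u] is the image of that class under the map from [A] to [P] sending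
    1 to [x0]. *)
Lemma top_dual_Ext_class M (R : projres M) g (P : rmod A) :
  indecomposable P -> projective P -> iso (top P) (top (dual (ExtA_of R g))) ->
  let E := chain_ext (pr_chain R) g in
  exists u : rhom (prZ R g) P, ~ extends E u /\
    forall Q (h : rhom P Q), projective Q -> ~ extends E (rhom_comp h u) ->
      exists k : rhom Q P, forall x, k (h x) = x.
Proof.
move=> indP pP /iso_rhom[i0 [ii si]] E.
have [q [sq qE]] := quo_rhom (rad P).
have [q' [sq' _]] := quo_rhom (rad (dual (ExtA_of R g))).
have [j [_ ij]] := inv_rhom ii si.
have ji y : j (i0 y) = y by apply: (inj_eq ii); rewrite ij.
have st : surj (rhom_comp j q').
  by move=> y; have [f hf] := sq' (i0 y); exists f; rewrite rcompE hf ji.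
have [x0 x0P] := notin_rad_ex indP.
have qx0 : q x0 <> 0 by move=> /qE; apply/negP.
have [l lx0] := functional_ex qx0.
have [a [b [hb ba]]] := indecomposable_retract_reg indP pP x0P.
have [x hx] := dual_quotient_elt l st; have [f hf] := Ext_act_eq0 x.
exists (rhom_comp b f); split=> [ext|Q h pQ next].
  (* If [u] extends, so does [a b f], which is [f] multiplied by [a x0]; hence [a x0] annihilates
     [x]. Since [x0 ** a x0 = x0], the functional would vanish at the class of [x0]. *)
  apply: lx0; have e0 : x ** (a x0 : A) = 0.
    apply/hf; apply: (extends_eq _ (extends_comp a ext)) => y.
    by rewrite !rcompE lmulE hb rhomP.
  have := proj1 (hx _) e0 (q x0); rewrite -rhomP.
  by have -> : x0 ** (a x0 : A) = x0 by rewrite -hb ba.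
have [k hk] : exists k : rhom Q (reg A),
    ~ extends E (rhom_comp k (rhom_comp h (rhom_comp b f))).
  by apply: contrapT => h0; apply: next; apply: extends_reg => // k;
    apply: contrapT => hk; apply: h0; exists k.
pose al : A := k (h x0).
have xal : x ** al <> 0.
  move=> /hf e; apply: hk; apply: extends_eq e => y.
  by rewrite !rcompE lmulE hb !rhomP.
have [y hy] : exists y, l (y ** al) <> 0.
  apply: contrapT => h0; apply: xal; apply/hx => y.
  by apply: contrapT => hy; apply: h0; exists y.
have [m hm] := generated_map y.
have [c hc] := generated_map (sval (cid (sq y))).
have qc d : q (c d) = m d by rewrite hc rhomP hm; case: cid => w /= ->.
(* The scalar [al] does not kill [x], so some [y] has [l (y ** al)] nonzero. With [c] lifting the
   map generated by [y], the endomorphism [c k h] sends [x0] outside the radical and is thus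
   bijective, which splits [h]. *)
pose phi := rhom_comp c (rhom_comp k h).
have sphi : surj phi.
  apply: (surj_of_notin_rad (x := x0)) => //; apply/negP => /qE.
  rewrite !rcompE qc hm => e; apply: hy; rewrite -/al in e.
  by rewrite [y ** al]e linear0.
have [psi [psiK _]] := inv_rhom (surj_inj sphi (leqnn _)) sphi.
exists (rhom_comp psi (rhom_comp c k)) => z.
by rewrite -[RHS]psiK !rcompE.
Qed.

End ExtClasses.

(** * Socles and minimality *)

Section Socle.
Variables (s : side) (K : fieldType) (A : falgType K).
Implicit Types M N S I : module s A.

Lemma simple_inj S M (f : rhom S M) : simple_mod S -> inj f \/ forall x, f x = 0.
Proof.
move=> [_ sS]; have [k0|kT] := sS (ker_mod f); first by left; exact/lker_inj.
by right=> x; apply/rker_mem; rewrite kT memvf.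
Qed.

Lemma simple_submod_ex M (W : submod M) x : x \in (W : {vspace M}) -> x <> 0 ->
  exists U : submod M, simple_mod (sub_mod U).
Proof.
have [d le] := ubnP (\dim W); elim: d => // d IHd in W x le * => xW x0.
have [sW|nW] := pselect (simple_mod (sub_mod W)); first by exists W.
have [V [V0 VT]] : exists V : submod (sub_mod W),
    (V : {vspace (sub_mod W)}) <> 0%VS /\ (V : {vspace (sub_mod W)}) <> fullv.
  apply: contrapT => h; apply: nW; split=> [/zero_modP z|V].
    by have [y yx] := incl_ex xW; apply: x0; rewrite -yx (z y) linear0.
  by apply: contrapT => /not_orP[n1 n2]; apply: h; exists V.
pose W' := im_mod (rhom_comp (incl W) (incl V)).
have W'W : (W' <= W)%VS.
  by apply/subvP => _ /memv_imgP[y _ ->]; rewrite rcompE; exact: incl_mem.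
have [y yV y0] : exists2 y, y \in (V : {vspace _}) & y <> 0.
  apply: contrapT => h; apply: V0; apply/eqP; rewrite -subv0; apply/subvP => y yV.
  suff -> : y = 0 by exact: mem0v.
  by apply: contrapT => y0; apply: h; exists y.
apply: (IHd W' (incl W y)); first last.
- by move=> /incl_inj.
- by apply/rim_mem; have [z <-] := incl_ex yV; exists z; rewrite rcompE.
rewrite ltnS in le; apply: leq_trans le; rewrite ltnNge; apply/negP => le'.
have eW : (W' : {vspace M}) = W by apply/eqP; rewrite eqEdim W'W.
apply: VT; apply/vspaceP => z; rewrite memvf.
have : incl W z \in (W' : {vspace M}) by rewrite eW incl_mem.
move=> /rim_mem[t]; rewrite rcompE => /(inj_eq (@incl_inj _ _ _ _ W)) <-.
exact: incl_mem.
Qed.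

Lemma submod_eq M (U W : submod M) : (U : {vspace M}) = W -> U = W.
Proof.
case: U W => [U hU] [W hW] /= e; move: hU; rewrite e => hU.
by congr SubMod; exact: Prop_irrelevance.
Qed.

(* If U and W meet trivially, the inclusion of U extends to an endomorphism of I
   killing W. *)
Lemma indecomposable_injective_uniform I (U W : submod I) y :
  indecomposable I -> injective_mod I ->
  (forall x, x \in (U : {vspace I}) -> x \in (W : {vspace I}) -> x = 0) ->
  y \in (W : {vspace I}) -> y <> 0 -> forall x, x \in (U : {vspace I}) -> x = 0.
Proof.
move=> indI iI UW yW y0 x xU; have [q [sq qE]] := quo_rhom W.
have [z|p hp] := injective_extend (g := rhom_comp q (incl U)) (incl U) iI.
  by rewrite rcompE => /qE/(UW _ (incl_mem z))/incl_inj.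
have [fi|[n fn]] := indecomposable_endo (rhom_comp p q) indI.
  by case: y0; apply: fi; rewrite rcompE (proj2 (qE y) yW) linear0.
have [z <-] := incl_ex xU; rewrite -[LHS](riter_fixed (f := rhom_comp p q) n) ?fn //.
by rewrite rcompE -[RHS]hp rcompE.
Qed.

(** By uniformity any simple submodule meets [U] nontrivially, hence lies in it, so the socle is
    [U]. *)
Lemma soc_simple I : indecomposable I -> injective_mod I -> simple_mod (soc I).
Proof.
move=> indI iI; have [nI _] := indI.
have [x x0] := nonzero_ex nI.
have [U sU] : exists U : submod I, simple_mod (sub_mod U).
  apply: (simple_submod_ex (W := im_mod (rid I)) (x := x)) => //.
  by apply/rim_mem; exists x; rewrite ridE.
suff -> : soc I = sub_mod U by [].
congr sub_mod; apply: submod_eq => /=; apply/eqP; rewrite eqEsubv.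
apply/andP; split; last by apply/subvP => z zU; apply: mem_pspan; exists U.
apply: pspan_le => z [V sV zV]; have [q [sq qE]] := quo_rhom U.
have [qi|q0] := simple_inj (rhom_comp q (incl V)) sV; last first.
  by have [t <-] := incl_ex zV; apply/qE; rewrite -rcompE.
have [nU _] := sU; have [t t0] := nonzero_ex nU.
suff -> : z = 0 by exact: mem0v.
apply: (indecomposable_injective_uniform indI iI _ (incl_mem t)) zV =>
  [w wV wU|/incl_inj//].
by have [c cw] := incl_ex wV; rewrite -cw (qi c) ?linear0 // rcompE cw; exact/qE.
Qed.

End Socle.

(** * Consequences of minimality for lifts and extensions *)

Section Minimality.
Variables (s : side) (K : fieldType) (A : falgType K).
Implicit Types M N L : module s A.

Lemma lifts_comp n M N (E : yext n M N) L L' (c : rhom L N) (f : rhom L' L) :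
  lifts E c -> lifts E (rhom_comp c f).
Proof.
have from m M' N' (E' : yext m M' N') B (p : rhom B M') (c' : rhom L N') :
    lifts_from E' p c' -> lifts_from E' p (rhom_comp c' f).
  elim: m M' N' E' B p c' => [|m IHm] M' N' E' B p c' /=; last exact: IHm.
  by move=> [t ht]; exists (rhom_comp t f) => x; rewrite !rcompE ht.
case: n E => [|n] E /=; last exact: from.
by move=> c0 x; rewrite rcompE c0.
Qed.

Lemma lifts_eq n M N (E : yext n M N) L (c c' : rhom L N) :
  (forall x, c x = c' x) -> lifts E c -> lifts E c'.
Proof.
have from m M' N' (E' : yext m M' N') B (p : rhom B M') (d d' : rhom L N') :
    (forall x, d x = d' x) -> lifts_from E' p d -> lifts_from E' p d'.
  elim: m M' N' E' B p d d' => [|m IHm] M' N' E' B p d d' dd' /=; last exact: IHm.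
  by move=> [t ht]; exists t => x; rewrite ht.
case: n E => [|n] E /= cc'; last exact: from.
by move=> c0 x; rewrite -cc'.
Qed.

Lemma cochain_lifts_zero (D : cochain s A) n L (c : rhom L (dY D n)) :
  (forall x, c x = 0) -> lifts (cochain_ext n D) c.
Proof.
case: n c => [//|n] c c0; apply/cochain_lifts; exists (rzero _ _) => x.
by rewrite rzeroE linear0 c0.
Qed.

(** An element of the image of a lift [t] lying in the preceding cosyzygy comes from the kernel of
    [c], so it is zero. By essentiality [t = 0], hence [c = 0]. *)
Lemma lifts_inj_zero (D : cochain s A) n L (c : rhom L (dY D n)) :
  (forall i, essentialr (de D i)) -> lifts (cochain_ext n D) c -> inj c -> zero_mod L.
Proof.
move=> ess li ci; apply/zero_modP => x.
case: n c li ci => [|n] c; first by move=> c0; apply; exact: c0.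
move=> /cochain_lifts[t ht] ci; apply: (ci); rewrite -ht.
suff -> : t x = 0 by exact: linear0.
have [_ _ ex] := dses D n.
apply: (ess n (im_mod t)); last by apply/rim_mem; exists x.
move=> y /rim_mem[z e]; rewrite -e; suff -> : z = 0 by exact: linear0.
by apply: ci; rewrite -ht e; apply/ex; exists y.
Qed.

Lemma lifts_simple_zero (D : cochain s A) n S (c : rhom S (dY D n)) :
  (forall i, essentialr (de D i)) -> lifts (cochain_ext n D) c -> simple_mod S ->
  forall x, c x = 0.
Proof.
move=> ess li sS; have [ci|//] := simple_inj c sS.
by have [nS _] := sS; case: nS; exact: lifts_inj_zero ess li ci.
Qed.

(** On the kernel of [f] the difference is minus the inclusion, which is injective and lifts, so the
    kernel is zero. *)
Lemma lifts_sub_id_inj (D : cochain s A) n (f : rhom (dY D n) (dY D n)) :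
  (forall i, essentialr (de D i)) -> lifts (cochain_ext n D) (rsub f (rid _)) -> inj f.
Proof.
move=> ess li x fx; have li' := lifts_comp (incl (ker_mod f)) li.
have [y <-] := incl_ex (proj2 (rker_mem f x) fx).
suff /zero_modP K0 : zero_mod (sub_mod (ker_mod f)) by rewrite (K0 y) linear0.
apply: lifts_inj_zero ess li' _ => z.
rewrite rcompE rsubE ridE; have /rker_mem -> := incl_mem z.
by rewrite sub0r => /eqP; rewrite oppr_eq0 => /eqP/incl_inj.
Qed.

Lemma essentialr_zero M N (f : rhom M N) : essentialr f -> zero_mod M -> zero_mod N.
Proof.
move=> ef /zero_modP M0; apply/zero_modP => y.
apply: (ef (im_mod (rid N))); last by apply/rim_mem; exists y; rewrite ridE.
by move=> x _; rewrite (M0 x) linear0.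
Qed.

Lemma ladder_nonzero n (C : chain s A) (D : cochain s A)
    (a : rhom (cZ C n) (dY D 0%N)) (c : rhom (cZ C 0%N) (dY D n)) :
  (forall i, projective (cQ C i)) -> ladder (chain_ext C n) (cochain_ext n D) a c ->
  ~ extends (chain_ext C n) a -> exists x, c x <> 0.
Proof.
move=> pC la na; apply: contrapT => h; apply: na; apply: extends_of_lifts la _ _.
  exact: chain_all_mid.
by apply: cochain_lifts_zero => x; apply: contrapT => cx; apply: h; exists x.
Qed.

Lemma inj_retract_injective M N (f : rhom M N) : injective_mod M -> inj f ->
  essentialr f -> surj f.
Proof.
move=> iM fi ef y; have [r hr] := injective_extend (rid M) iM fi.
exists (r y); apply/esym/eqP; rewrite -subr_eq0; apply/eqP.
apply: (ef (ker_mod r)) => [x /rker_mem|]; first by rewrite hr ridE => ->; exact: linear0.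
by apply/rker_mem; rewrite linearB /= hr ridE subrr.
Qed.

Lemma injective_iso M N (f : rhom M N) :
  inj f -> surj f -> injective_mod N -> injective_mod M.
Proof.
by move=> fi fs; have [g [gf _]] := inv_rhom fi fs; exact: retract_injective gf.
Qed.

Lemma projective_iso M N (f : rhom M N) :
  inj f -> surj f -> projective M -> projective N.
Proof.
by move=> fi fs; have [g [_ fg]] := inv_rhom fi fs; exact: retract_projective fg.
Qed.

Lemma nonzero_fixed_bij M (f : rhom M M) x : indecomposable M -> f x = x -> x <> 0 ->
  inj f.
Proof.
move=> indM fx x0; have [//|[n fn]] := indecomposable_endo f indM.
by case: x0; rewrite -(riter_fixed n fx) fn.
Qed.

(** An extension [t] of [1 - h k] to the next projective term is shown to vanish modulo the image of
    [h]; restricting back to the syzygy, every [y] lies in that image. *)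
Lemma extends_superfluous_surj (C : chain s A) n L (h : rhom L (cZ C n))
    (k : rhom (cZ C n) L) :
  (forall i, superfluousr (cp C i)) ->
  extends (chain_ext C n) (rsub (rid _) (rhom_comp h k)) -> surj h.
Proof.
move=> sup; have qE x : rsub (rid _) (rhom_comp h k) x = x - h (k x).
  by rewrite rsubE ridE rcompE.
case: n h k qE => [|n] h k qE ext y.
  by exists (k y); apply/esym/eqP; rewrite -subr_eq0 -qE ext.
have [t ht] := ext; have [_ _ ex] := cses C n.
have [p [_ pE]] := quo_rhom (im_mod h).
have tW x : x \in (ker_mod (rhom_comp p t) : {vspace _}).
  (* Modulo the image of [h], [t] agrees on [x] and on [ce C n (t x)]; their difference is in the
     kernel and has the same image as [x] under [cp C n]. *)
  apply: (sup n) => {}x; exists (x - ce C n (t x)).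
    apply/rker_mem; rewrite rcompE; apply/pE/rim_mem; exists (k (t x)).
    rewrite linearB /= (_ : t (ce C n (t x)) = t x - h (k (t x))) ?subKr //.
    exact: etrans (ht (t x)) (qE (t x)).
  rewrite linearB /= (_ : cp C n (ce C n (t x)) = 0) ?subr0 //.
  by apply/ex; exists (t x).
have /rker_mem := tW (ce C n y); rewrite rcompE => /pE/rim_mem[x hx].
exists (x + k y); rewrite linearD /= hx.
by rewrite (_ : t (ce C n y) = y - h (k y)) ?subrK //; exact: etrans (ht y) (qE y).
Qed.

End Minimality.

(** * The final terms *)

Section Main.
Variables (K : fieldType) (A : falgType K).
Implicit Types M N S I P : rmod A.

(** Below degree [g] there are no extensions of [S] by projectives, so a null-homotopy passes along
    the whole ladder; for positive [g], [c] then factors through a map from [S] to a projective,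
    which is zero. Thus Hom(S, M) embeds in Ext^g(S, prZ R g). *)
Lemma grade_ladder_zero S (R0 : projres S) g M (R : projres M)
    (a : rhom (prZ R0 g) (prZ R g)) (c : rhom S M) :
  (forall i, (i < g)%N -> zero_mod (ExtA_of R0 i)) ->
  ladder (chain_ext (pr_chain R0) g) (chain_ext (pr_chain R) g) a c ->
  extends (chain_ext (pr_chain R0) g) a -> forall x, c x = 0.
Proof.
move=> E0 la ea.
have : lifts (chain_ext (pr_chain R) g) c.
  apply: (lifts_of_extends la ea); case: g a la ea E0 => [//|g] a _ _ E0.
  apply: chain_ext_cond => k kg f.
  have pQ : projective (R k.+1) by exact: pr_proj.
  have [t ht] := Ext_zero_extends_projective (i := k.+1) f pQ (E0 k.+1 kg).
  by exists t.
case: g a la ea E0 => [//|g] a _ _ E0 /chain_lifts[t ht] x.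
have t0 : forall y, t y = 0.
  exact: (Ext_zero_extends_projective (i := 0%N) t (@pr_proj _ _ _ _ R 0%N) (E0 0%N isT)).
by rewrite -ht t0 linear0.
Qed.

(** If [k < g], the [g]-th syzygy of [M] is zero, and [grade_ladder_zero] kills every map from [S]
    to [M]. *)
Lemma grade_le_pdim S (R0 : projres S) g M k (c : rhom S M) x :
  (forall i, (i < g)%N -> zero_mod (ExtA_of R0 i)) -> pdim_le M k -> c x <> 0 ->
  (g <= k)%N.
Proof.
move=> E0 [R Rk] cx; rewrite leqNgt; apply/negP => kg; apply: cx.
have pR0 : all_mid (@projective Rgt K A) (chain_ext (pr_chain R0) g).
  by apply: chain_all_mid; exact: pr_proj.
have [a la] := ladder_backward c (projective_lift_cond (chain_ext (pr_chain R) g) pR0).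
apply: (grade_ladder_zero E0 la); apply: extends_zero => y.
suff /zero_modP Z0 : zero_mod (prZ R g) by exact: Z0.
by case: g kg {E0 pR0 a la y} => // g kg; exact/prZ_zero/Rk.
Qed.

Section Data.
Variables (I P : rmod A) (g : nat).
Hypothesis AGp : exists RA : injcores (reg A), forall i, pdim_le (RA i) i.
Hypotheses (indI : indecomposable I) (injI : injective_mod I).
Hypotheses (indP : indecomposable P) (projP : projective P).
Hypothesis grade_lt : forall i, (i < g)%N -> zero_mod (ExtA i (soc I)).
Hypothesis topP : iso (top P) (top (dual (ExtA g (soc I)))).

Let R0 : projres (soc I) := free_res (soc I).
Let E0 := chain_ext (pr_chain R0) g.

Let socI_nonzero : exists x : soc I, x <> 0.
Proof. by have [nS _] := soc_simple indI injI; exact: nonzero_ex. Qed.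

Let projE0 : all_mid (@projective Rgt K A) E0.
Proof. by apply: chain_all_mid; exact: pr_proj. Qed.

Lemma soc_embeds_cosyzygy (D : cochain Rgt A) (u : rhom (prZ R0 g) (dY D 0%N))
    (j : rhom (soc I) (dY D g)) :
  ladder E0 (cochain_ext g D) u j -> ~ extends E0 u -> inj j.
Proof.
move=> la nu.
have [x jx] := ladder_nonzero (C := pr_chain R0) (@pr_proj _ _ _ _ R0) la nu.
by have [//|j0] := simple_inj j (soc_simple indI injI); case: jx; exact: j0.
Qed.

(** The socle embeds in the [g]-th term of the coresolution of [A]. Injectivity extends this map to
    [I] and gives a map back; their composite fixes the socle, so it is bijective and [I] is a
    retract of a term of projective dimension at most [g]. *)
Lemma injective_lift_dim : lift_dim I g.
Proof.
have [RA pdA] := AGp; pose CA := ic_cochain RA.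
have [u [nu _]] := top_dual_Ext_class indP projP topP.
have [x0 x0P] := notin_rad_ex indP.
have [a [b [_ ba]]] := indecomposable_retract_reg indP projP x0P.
have iA : all_mid (@injective_mod Rgt K A) (cochain_ext g CA).
  by apply: cochain_all_mid; exact: ic_inj.
have [j lj] := ladder_forward E0 (rhom_comp a u) iA.
have ij : inj j.
  apply: (soc_embeds_cosyzygy (D := CA) lj) => /(extends_comp b) eu; apply: nu.
  by apply: extends_eq eu => x; rewrite !rcompE ba.
have [ei _ _] := dses CA g; pose f := rhom_comp (de CA g) j.
have fi : inj f by move=> x; rewrite rcompE => /ei/ij.
pose v := incl (SubMod (@soc_subproof Rgt K A I)).
have vi : inj v by exact: incl_inj.
have [m hm] := injective_extend f (@ic_inj _ _ _ _ RA g) vi.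
have [r hr] := injective_extend v injI fi.
have rm_fix x : rhom_comp r m (v x) = v x by rewrite rcompE hm hr.
have [x xN] := socI_nonzero.
have rmi : inj (rhom_comp r m).
  by apply: nonzero_fixed_bij (rm_fix x) _ => // /vi.
have [k [kK _]] := inv_rhom rmi (inj_surj rmi (leqnn _)).
apply: (lift_dim_retract (i := m) (r := rhom_comp k r)) (pdim_lift_dim (pdA g)) => y.
by rewrite rcompE -[RHS]kK rcompE.
Qed.

Lemma projres_stops (R : projres I) : minimal_projres R ->
  forall i, (g < i)%N -> zero_mod (R i).
Proof.
move=> mR; have [R' _] := minimal_injcores_ex (prZ R g.+1).
exact: minimal_projres_zero R' mR injective_lift_dim.
Qed.

Lemma pdim_eq_grade r : has_pdim I r -> r = g.
Proof.
move=> [pr minr]; apply/eqP; rewrite eqn_leq; apply/andP; split.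
  by have [R mR] := minimal_projres_ex I; apply: minr; exists R; exact: projres_stops.
have [x x0] := socI_nonzero.
pose v := incl (SubMod (@soc_subproof Rgt K A I)).
apply: (grade_le_pdim (c := v) (x := x) grade_lt pr).
by move=> /incl_inj.
Qed.

(** The socle of [I] embeds in the [g]-th cosyzygy of [P], so the [g]-th term of any injective
    coresolution is nonzero. *)
Lemma grade_le_idim k : idim_le P k -> (g <= k)%N.
Proof.
move=> [R Rk]; rewrite leqNgt; apply/negP => kg; pose D := ic_cochain R.
have [u [nu _]] := top_dual_Ext_class indP projP topP.
have iD : all_mid (@injective_mod Rgt K A) (cochain_ext g D).
  by apply: cochain_all_mid; exact: ic_inj.
have [j lj] := ladder_forward E0 u iD; have ij := soc_embeds_cosyzygy (D := D) lj nu.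
have [x x0] := socI_nonzero; apply: x0.
have [ei _ _] := dses D g; apply: ij; apply: ei.
exact: (proj1 (zero_modP _) (Rk g kg)).
Qed.

(** * Comparison of the last cosyzygy of P and the last syzygy of I *)

Section Comparison.
Variables (RP : injcores P) (R : projres I).
Hypotheses (minRP : minimal_injcores RP) (minR : minimal_projres R).

Let CP := ic_cochain RP.
Let Q := prZ R g.

(** Since the terms beyond [g] vanish, the [g]-th syzygy is isomorphic to the [g]-th term. *)
Let projQ : projective Q.
Proof.
have [_ sp _] := pr_ses R g; apply: projective_iso sp _; last exact: pr_proj.
exact/prp_inj/prZ_zero/projres_stops.
Qed.

Lemma cosyzygy_iso_and_syzygy_iso :
  (exists f : rhom (dY CP g) I, inj f /\ surj f) /\
  (exists h : rhom P Q, inj h /\ surj h).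
Proof.
have [RA pdA] := AGp; pose CA := ic_cochain RA.
have [RQ _] := minimal_injcores_ex Q; pose CQ := ic_cochain RQ.
pose ER := chain_ext (pr_chain R) g.
pose EP := cochain_ext g CP; pose EA := cochain_ext g CA; pose EQ := cochain_ext g CQ.
have iP : all_mid (@injective_mod Rgt K A) EP by apply: cochain_all_mid; exact: ic_inj.
have iA : all_mid (@injective_mod Rgt K A) EA by apply: cochain_all_mid; exact: ic_inj.
have iQ : all_mid (@injective_mod Rgt K A) EQ by apply: cochain_all_mid; exact: ic_inj.
have pR : all_mid (@projective Rgt K A) ER by apply: chain_all_mid; exact: pr_proj.
have essP := ic_cochain_essential minRP.
have sS := soc_simple indI injI; have [s0 s0N] := socI_nonzero.
have [u [nu hu]] := top_dual_Ext_class indP projP topP.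
have [x0 x0P] := notin_rad_ex indP.
have [a [b [_ ba]]] := indecomposable_retract_reg indP projP x0P.
pose v := incl (SubMod (@soc_subproof Rgt K A I)).
have vi : inj v by exact: incl_inj.
have [j lj] := ladder_forward E0 u iP; have ij := soc_embeds_cosyzygy (D := CP) lj nu.
have [a' la] : exists a', ladder EP EA a a' by exact: ladder_forward.
have [b' lb] : exists b', ladder EA EP b b' by exact: ladder_forward.
have [io hio] := injective_extend v injI ij.
have [z lz] : exists z, ladder ER EQ (rid Q) z by exact: ladder_forward.
have [vg lv] := ladder_backward v (projective_lift_cond ER projE0).
have nvg : ~ extends E0 vg.
  move=> ev; apply: s0N; apply: vi.
  exact: (grade_ladder_zero (R0 := R0) (R := R) grade_lt lv ev).
pose w := rhom_comp z io.
(* This is where the Auslander condition enters: it lets a map between cosyzygies be lifted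
   backwards through the injective coresolution of [A]. *)
have [hA lh] : exists hA, ladder EA EQ hA (rhom_comp w b').
  apply: ladder_backward; apply: lift_cond_cochain => i _ f.
  by apply: (pdim_lift_dim (pdA i)) => k; exact: ic_inj.
pose h := rhom_comp hA a; have lah := ladder_comp la lh.
(* As [b a] is the identity, [b' a' - 1] lifts to the preceding injective; restricted to a simple
   module such a map is zero by minimality. *)
have bj x : b' (a' (j x)) = j x.
  have := ladder_sub (ladder_comp la lb) (ladder_id EP).
  move=> /lifts_of_extends_inj/(_ iP) li.
  have {}li : lifts EP (rsub (rhom_comp b' a') (rid _)).
    by apply: li; apply: extends_zero => y; rewrite rsubE rcompE ridE ba subrr.
  have := lifts_simple_zero essP (lifts_comp j li) sS x.
  by rewrite rcompE rsubE rcompE ridE => /eqP; rewrite subr_eq0 => /eqP.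
(* The ladders through [h u] and through [vg] have the same right end map [z v], so both classes
   vanish or neither does. *)
have nhu : ~ extends E0 (rhom_comp h u).
  move=> e; apply: nvg; have li := lifts_of_extends_inj (ladder_comp lj lah) iQ e.
  have lvz := ladder_comp lv lz.
  have : extends E0 (rhom_comp (rid Q) vg).
    apply: (extends_of_lifts lvz projE0); apply: lifts_eq li => x.
    by rewrite !rcompE bj hio.
  by apply: extends_eq => x; rewrite rcompE ridE.
have [k kh] := hu _ h projQ nhu.
have [k' lk] : exists k', ladder EQ EP k k' by exact: ladder_forward.
(* The map induced on the cosyzygy of [P] by [k h = 1]; it is the identity modulo maps that lift,
   hence injective and bijective. *)
pose ka := rhom_comp k' (rhom_comp (rhom_comp w b') a').
have kai : inj ka.
  apply: lifts_sub_id_inj essP _.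
  apply: (lifts_of_extends_inj (ladder_sub (ladder_comp lah lk) (ladder_id EP)) iP).
  by apply: extends_zero => x; rewrite rsubE rcompE ridE kh subrr.
pose i1 := rhom_comp io (rhom_comp b' a'); pose th := rhom_comp k' z.
have thi x : th (i1 x) = ka x by rewrite !rcompE.
have i1i : inj i1 by move=> x i1x; apply: kai; rewrite -thi i1x linear0.
have [kb [kbK _]] := inv_rhom kai (inj_surj kai (leqnn _)).
have i1s : surj i1.
  (* [e] fixes the image of [i1], so it is not nilpotent; being bijective and factoring through
     [i1], it makes [i1] surjective. *)
  pose e := rhom_comp i1 (rhom_comp kb th).
  have ei1 x : e (i1 x) = i1 x by rewrite 2!rcompE thi kbK.
  have ei : inj e by apply: nonzero_fixed_bij (ei1 (j s0)) _ => // /i1i/ij.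
  move=> y; have [x <-] := inj_surj ei (leqnn _) y.
  by exists (kb (th x)); rewrite !rcompE.
split; first by exists i1.
have hi : inj h by move=> x hx; rewrite -[LHS]kh hx linear0.
exists h; split=> //.
apply: (extends_superfluous_surj (C := pr_chain R) (n := g) (k := k)).
  exact: pr_chain_superfluous.
set q := rsub _ _.
have [q' lq] : exists q', ladder EQ EQ q q' by exact: ladder_forward.
have [i1' [_ i1K]] := inv_rhom i1i i1s.
have ext : extends ER (rhom_comp q (rid Q)).
  apply: (extends_of_lifts (ladder_comp lz lq) pR).
  (* Since [q h = 0], the induced map [q' z i1] lifts; cancelling the isomorphism [i1] shows that
     [q' z] lifts, so [q] extends. *)
  have li : lifts EQ (rhom_comp q' (rhom_comp (rhom_comp w b') a')).
    apply: (lifts_of_extends_inj (ladder_comp lah lq) iQ); apply: extends_zero => x.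
    by rewrite (rcompE q h) rsubE ridE (rcompE h k) kh subrr.
  apply: lifts_eq (lifts_comp i1' li) => x.
  by rewrite -[X in _ = _ X](i1K x) !rcompE.
by apply: extends_eq ext => x; rewrite rcompE ridE.
Qed.

End Comparison.
End Data.
End Main.

(** * Transport along isomorphisms and conclusion *)

Lemma iso_trans (s : side) (K : fieldType) (A : falgType K) (M N L : module s A) :
  iso M N -> iso N L -> iso M L.
Proof.
move=> /iso_rhom[f [fi fs]] /iso_rhom[g [gi gs]].
apply: (iso_of (f := rhom_comp g f)) => [x|y]; first by rewrite rcompE => /gi/fi.
by have [z <-] := gs y; have [x <-] := fs z; exists x; rewrite rcompE.
Qed.

Lemma iso_sym (s : side) (K : fieldType) (A : falgType K) (M N : module s A) :
  iso M N -> iso N M.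
Proof.
move=> /iso_rhom[f [fi fs]]; have [g [gf fg]] := inv_rhom fi fs.
apply: (iso_of (f := g)) => [y gy|x]; first by rewrite -[y]fg gy linear0.
by exists (f x).
Qed.

(** An injective cosyzygy splits off the term it embeds in, and essentiality makes this embedding an
    isomorphism; every later cosyzygy is then zero. *)
Lemma minimal_injcores_stops (s : side) (K : fieldType) (A : falgType K)
    (M : module s A) (R : injcores M) n :
  minimal_injcores R -> injective_mod (icY R n) ->
  iso (R n) (icY R n) /\ forall i, (n < i)%N -> zero_mod (R i).
Proof.
move=> /ic_cochain_essential ess iY; have [ei sp ex] := ic_ses R n.
have se : surj (ice R n) by exact: inj_retract_injective iY ei (ess n).
split; first exact/iso_sym/(iso_of ei se).
have YJ i : zero_mod (icY R i) -> zero_mod (R i) by exact: essentialr_zero (ess i).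
have JY i : zero_mod (R i) -> zero_mod (icY R i.+1).
  move=> J0; apply/zero_modP => y; have [_ spi _] := ic_ses R i.
  by have [x <-] := spi y; exact: zero_rhom.
move=> i /subnKC <-; elim: (i - n.+1)%N => [|k IHk]; last by rewrite addnS; exact/YJ/JY.
rewrite addn0; apply: YJ; apply/zero_modP => y; have [x <-] := sp y.
by apply/ex; exact: se.
Qed.

Theorem theorem3p12 (K : fieldType) (A : falgType K)
    (hA : Auslander_Gorenstein A)
    (I : rmod A) (r : nat) (P : rmod A)
    (hI : indecomposable I) (injI : injective_mod I) (pdimI : has_pdim I r)
    (hP : indecomposable P) (projP : projective P)
    (topP : grade_bij (soc I) (top P)) :
  has_idim P r /\
  (forall R : projres I, minimal_projres R -> final_term R r P) /\
  (forall R : injcores P, minimal_injcores R -> final_term R r I).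
Proof.
have [[RA [_ pdA]] _] := hA; have [g [_ grade_lt] topE] := topP.
have AGp : exists RA : injcores (reg A), forall i, pdim_le (RA i) i by exists RA.
have rg := pdim_eq_grade AGp hI injI hP projP grade_lt topE pdimI; subst r.
have stops := projres_stops AGp hI injI hP projP topE.
have core := cosyzygy_iso_and_syzygy_iso AGp hI injI hP projP grade_lt topE.
(* [core] compares a resolution with a coresolution, so each final term is found with an auxiliary
   minimal one on the other side. *)
have [R0 mR0] := minimal_projres_ex I; have [RP0 mRP0] := minimal_injcores_ex P.
have inj_final (RP : injcores P) : minimal_injcores RP -> final_term RP g I.
  move=> mRP; have [[f [fi fs]] _] := core RP R0 mRP mR0.
  have [e z] := minimal_injcores_stops mRP (injective_iso fi fs injI).
  by split=> //; apply: iso_trans e _; exact: iso_of fi fs.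
split; last split=> // R mR.
  split; last by move=> k; exact: grade_le_idim hI injI hP projP topE _.
  by exists RP0; have [] := inj_final RP0 mRP0.
split; last exact: stops.
have [_ [h [hi hs]]] := core RP0 R mRP0 mR.
apply: iso_sym; apply: iso_trans (iso_of hi hs) _; apply: iso_sym.
have [_ sp _] := pr_ses R g; apply: iso_of sp.
exact/prp_inj/prZ_zero/stops.
Qed.
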